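(* Let $m\ge2$ and let $C=\{c_0,\ldots,c_{m-1}\}\subseteq 2\mathbb{Z}+1$ be a set of $m$ odd integers satisfying $C\equiv\{1,3\}\pmod 4$. Let $\mu$ be the Borel probability measure on $\mathcal{L}=C^\infty$ given by $\mu=\tilde\mu\circ\pi^{-1}$. Then for $\mu$-a.e. $L\in\mathcal{L}$, the set $\Lambda(L)$ is a spectrum for $\mu_4$.
   Context: $\mu_4$ denotes the middle-fourth Cantor measure: the unique Borel probability measure on $\mathbb{R}$ satisfying $\mu_4(\cdot)=\frac12\mu_4\circ\tau_1^{-1}(\cdot)+\frac12\mu_4\circ\tau_2^{-1}(\cdot)$, where $\tau_1(x)=4^{-1}x$ and $\tau_2(x)=4^{-1}(x+2)$. A discrete set $\Lambda\subseteq\mathbb{R}$ is a spectrum for a Borel probability measure $\nu$ on $\mathbb{R}$ if the family $\{e^{2\pi i\lambda x}:\lambda\in\Lambda\}$ is an orthonormal basis of $L^2(\nu)$. $\Sigma_m^\infty=\{0,1,\ldots,m-1\}^\infty$ is the space of infinite words over $\{0,\ldots,m-1\}$; the cylinder set $[i_1\cdots i_n]$ is the set of words in $\Sigma_m^\infty$ that begin with $i_1\cdots i_n$; $\tilde\mu$ is the unique Borel probability measure on $\Sigma_m^\infty$ with $\tilde\mu([i_1\cdots i_n])=m^{-n}$ for every finite word. The map $\pi:\Sigma_m^\infty\to C^\infty$ is the bijection $\pi(i_1i_2i_3\cdots)=c_{i_1}c_{i_2}c_{i_3}\cdots$. $C\equiv\{1,3\}\pmod 4$ means that the set of residues modulo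 4 of the elements of $C$ is $\{1,3\}$ (both residues occur). A sequence $L\in C^\infty$ is regarded as a label of the complete infinite binary tree by writing its entries as $$L=a_{1,1}\,a_{2,1}a_{2,3}\,a_{3,1}a_{3,3}a_{3,5}a_{3,7}\cdots,$$ i.e. for $n\ge1$ and odd $k$ with $1\le k\le 2^n-1$, $a_{n,k}$ is the entry of $L$ at position $2^{n-1}+\frac{k-1}{2}$; one also sets $a_{n,k}=0$ for even $k$ with $0\le k\le 2^n-2$. A path is a sequence $(k_n)_{n\ge1}$ with $k_1\in\{0,1\}$ and $k_{n+1}\in\{2k_n,2k_n+1\}$ for all $n\ge 1$ (so $0\le k_n\le 2^n-1$). Define $$\Lambda(L)=\left\{\sum_{i=1}^n 4^{i-1}a_{i,k_i}:\ (k_i)_{i\ge1}\text{ a path},\ n\in\mathbb{N}\right\}.$$ *)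

(* Defs.v *)
From HB Require Import structures.
From mathcomp Require Import all_boot all_order all_algebra finmap.
From mathcomp Require Import complex.
From mathcomp Require Import all_classical all_reals all_analysis.

Set Implicit Arguments.
Unset Strict Implicit.
Unset Printing Implicit Defensive.

Import Order.TTheory GRing.Theory Num.Theory.
Import numFieldNormedType.Exports.

Local Open Scope classical_set_scope.
Local Open Scope ring_scope.

Section ComplexL2.
Context {d : measure_display} {T : measurableType d} {R : realType}.
Variable nu : {measure set T -> \bar R}.

Definition cnorm2 (f : T -> R[i]) : \bar R :=
  Lnorm nu 2%:E (fun x => (Normc.normc (f x))%:E).

Definition complexL2 : set (T -> R[i]) :=
  [set f | [/\ measurable_fun setT (fun x => complex.Re (f x)),
               measurable_fun setT (fun x => complex.Im (f x)) &
               (cnorm2 f < +oo)%E]].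

Definition cinner (f g : T -> R[i]) : R[i] :=
  Complex (\int[nu]_x complex.Re (f x * conjc (g x)))
          (\int[nu]_x complex.Im (f x * conjc (g x))).

(* Totality says that the finite linear combinations are dense in L^2(nu);
   elements of L^2(nu) are represented by functions, not a.e. classes. *)
Definition orthonormal_basis (I : choiceType) (A : set I)
    (e : I -> T -> R[i]) : Prop :=
  [/\ forall i, A i -> complexL2 (e i),
      forall i j, A i -> A j -> cinner (e i) (e j) = (i == j)%:R &
      forall f, complexL2 f -> forall eps : R, 0 < eps ->
        exists (s : seq I) (a : I -> R[i]),
          (forall i, i \in s -> A i) /\
          (cnorm2 (fun x => f x - \sum_(i <- s) a i * e i x)%R < eps%:E)%E].

End ComplexL2.

Section Spectrum.
Context {R : realType}.

Definition expo (lambda x : R) : R[i] :=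
  Complex (cos (2 * pi * lambda * x)) (sin (2 * pi * lambda * x)).

Definition is_discrete (A : set R) : Prop := A `<=` isolated A.

Definition spectrum (nu : probability (measurableTypeR R) R)
    (Lam : set R) : Prop :=
  is_discrete Lam /\ orthonormal_basis nu Lam expo.

Definition tau1 (x : R) : R := 4^-1 * x.
Definition tau2 (x : R) : R := 4^-1 * (x + 2).

Definition middle_fourth_Cantor
    (nu : probability (measurableTypeR R) R) : Prop :=
  forall A : set (measurableTypeR R), measurable A ->
    (nu A = 2^-1%:E * nu (tau1 @^-1` A) + 2^-1%:E * nu (tau2 @^-1` A))%E.

End Spectrum.

(* Infinite words over A, indexed from 0, with the product of the discrete
   topologies.  The letter a0 only serves as a witness that A is nonempty, as
   MathComp-Analysis requires measurable types to be pointed; neither the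
   topology nor the Borel sets depend on it. *)
Definition words (A : choiceType) (a0 : A) : Type :=
  prod_topology (fun _ : nat => discrete_topology A).

HB.instance Definition _ (A : choiceType) (a0 : A) :=
  Topological.on (words a0).
HB.instance Definition _ (A : choiceType) (a0 : A) :=
  isPointed.Build (words a0) (fun=> a0).

Definition borel_words (A : choiceType) (a0 : A) :=
  g_sigma_algebraType (@open (words a0)).

Definition cylinder (A : choiceType) (w : seq A) : set (nat -> A) :=
  [set u | mkseq u (size w) = w].

Definition word_map (A B : choiceType) (a0 : A) (f : A -> B)
    (u : borel_words a0) : borel_words (f a0) := fun n => f (u n).
Arguments word_map {A B} a0 f u.

Definition letter0 (m : nat) (hm : (2 <= m)%N) : 'I_m := Ordinal (ltnW hm).

(* a_{n,k}: positions in L are counted from 1, whereas L is indexed from 0. *)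
Definition tree_label (L : nat -> int) (n k : nat) : int :=
  if odd k then L (2 ^ n.-1 + k.-1./2).-1 else 0.

(* Only the values k n with n >= 1 are meaningful. *)
Definition is_path (k : nat -> nat) : Prop :=
  (k 1 = 0 \/ k 1 = 1)%N /\
  forall n, (1 <= n)%N -> (k n.+1 = 2 * k n \/ k n.+1 = 2 * k n + 1)%N.

Definition Lambda (R : realType) (L : nat -> int) : set R :=
  [set x | exists (k : nat -> nat) (n : nat), [/\ is_path k, (1 <= n)%N &
    x = (\sum_(1 <= i < n.+1) 4 ^+ i.-1 * tree_label L i (k i))%:~R]].

(* Main.v *)
Require Import Defs.
From HB Require Import structures.
From mathcomp Require Import all_boot all_order all_algebra finmap.
From mathcomp Require Import complex.
From mathcomp Require Import all_classical all_reals all_analysis.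
From mathcomp Require Import measurable_realfun ring lra zify.

Set Implicit Arguments.
Unset Strict Implicit.
Unset Printing Implicit Defensive.

Import Order.TTheory GRing.Theory Num.Theory.
Import numFieldNormedType.Exports.

Local Open Scope classical_set_scope.
Local Open Scope ring_scope.

(** The maps [tau1] and [tau2] split L^2(mu4) into two copies of itself.  On the two
    copies [expo s] becomes [expo (s / 4)] and [exp (i pi s) expo (s / 4)], while the
    frequencies of a labelled tree with odd root label [a] are the [4 l], with [l] a
    frequency of the left subtree, and the [a + 4 l], with [l] a frequency of the
    right subtree.  By the parallelogram law ([sqint_join]) the squared distance
    D(s) from [expo s] to the span of these exponentials satisfies

      D(s) <= cos^2 (pi s / 2) D_left(s / 4) + sin^2 (pi s / 2) D_right((s - a) / 4).

    Starting from the bound min(1, 64 s^2) of the distance to the constants, [n]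
    steps of this recursion give [tree_error], which bounds D
    ([exists_tree_poly_expo]).

    The root label and the labels of the two subtrees are independent.  Hence the mean
    of the [n]-th error over all labels is the [n]-th iterate of a deterministic
    operator, [avg_step] ([word_mean_tree_error]).  This operator preserves constants,
    and its iterates contract to 0 on every interval [-K, K] that is invariant under
    all the branches: near 0 they are bounded by a multiple of s^2, and a
    neighbourhood of 0 is reached from every point with probability bounded below.
    Indeed dividing by 4 leads to 0 unless an odd integer is met; there some letter
    leads to a half-odd number, because the letters realise both odd residues modulo
    4, and from a half-odd number dividing by 4 never meets an odd integer
    ([iter_bump_gt0], [error_contracts], [avg_error_to0]).  By Markov's inequality
    almost every labelling makes the errors arbitrarily small, simultaneously for all
    subtrees and all rational frequencies ([ae_tree_error_small]).

    For such a labelling every [expo s] with [s] rational is approximated in every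
    subtree.  The same splitting shows by induction on [n] that the products of
    [expo s] with the indicator of [j / 4^n, +oo[ are approximated too
    ([approximable_expo_ray]): for [n = 0] that indicator is constant on the support
    of mu4.  These half-lines generate the Borel sets, so all indicators, and then all
    square-integrable functions, are approximated ([approximable_complexL2]).

    Orthogonality holds for every odd labelling: two different frequencies separate at
    one level and differ by [4^j] times an odd number ([tree_value_diff]), where the
    Fourier transform of mu4 vanishes ([cantor_fourier_zero]). *)

(** * Trigonometric preliminaries *)

Section Trigonometry.
Context {R : realType}.
Implicit Types (x y : R) (n : int).

Lemma periodic_int (f : R -> R) (T : R) :
  periodic f T -> forall n x, f (x + T * n%:~R) = f x.
Proof.
move=> fT [k|k] x; first by rewrite -pmulrn mulr_natr (periodicn fT).
rewrite NegzE mulrNz mulrN -pmulrn mulr_natr.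
by rewrite -[in RHS](subrK (T *+ k.+1) x) (periodicn fT).
Qed.

Lemma cosD2piz n x : cos (x + 2 * pi * n%:~R) = cos x.
Proof. by rewrite mulr_natl (periodic_int (@cosD2pi R)). Qed.

Lemma sinD2piz n x : sin (x + 2 * pi * n%:~R) = sin x.
Proof. by rewrite mulr_natl (periodic_int (@sinD2pi R)). Qed.

Lemma cosDpi_odd n x : cos (x + pi * (2 * n + 1)%:~R) = - cos x.
Proof.
rewrite -(cosD2piz n x) -cosDpi; congr cos.
by rewrite intrD intrM; ring.
Qed.

Lemma sinDpi_odd n x : sin (x + pi * (2 * n + 1)%:~R) = - sin x.
Proof.
rewrite -(sinD2piz n x) -sinDpi; congr sin.
by rewrite intrD intrM; ring.
Qed.

(** Subtracting an even integer moves [x] to [-1, 1[, where the cosine vanishes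
    only at the left end. *)
Lemma cos_pihalf_eq0 x :
  cos (pi / 2 * x) = 0 -> exists n, x = (2 * n + 1)%:~R.
Proof.
move=> cx0; pose n := Num.floor ((x + 1) / 2).
have /andP[n1 n2] := floor_itv ((x + 1) / 2); rewrite -/n in n1 n2.
pose y := x - 2 * n%:~R.
have y1 : -1 <= y by rewrite /y; lra.
have y2 : y < 1 by move: n2; rewrite /y intrD; lra.
have cy0 : cos (pi / 2 * y) ^+ 2 = 0.
  have e : pi / 2 * x = pi / 2 * y + pi * n%:~R by rewrite /y; field.
  have [k [nk|nk]] : exists k : int, n = 2 * k \/ n = 2 * k + 1.
    by exists (n %/ 2)%Z; lia.
  - have e' : pi / 2 * x = pi / 2 * y + 2 * pi * k%:~R.
      by rewrite e nk intrM; ring.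
    by move: cx0; rewrite e' cosD2piz => ->; rewrite expr0n.
  - have := cosDpi_odd k (pi / 2 * y).
    by rewrite -nk -e cx0 => /esym/eqP; rewrite oppr_eq0 => /eqP ->; rewrite expr0n.
have pi0 := @pi_gt0 R.
move: y1; rewrite le_eqVlt => /predU1P[y1|y1].
  by exists (n - 1); rewrite intrD intrM intrB; move: y1; rewrite /y; lra.
have : 0 < cos (pi / 2 * y).
  by apply: cos_gt0_pihalf; apply/andP; split; nra.
by move/(exprn_gt0 2); rewrite cy0 ltxx.
Qed.

Lemma sin_le_id x : 0 <= x -> sin x <= x.
Proof.
move=> x0.
have [|c _] := MVT_segment x0 (fun y _ => is_derive_sin y).
  by apply: continuous_subspaceT => y; exact: continuous_sin.
by rewrite sin0 !subr0 => ->; rewrite ler_piMl// cos_le1.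
Qed.

Lemma sqr_sin_le x : sin x ^+ 2 <= x ^+ 2.
Proof.
wlog x0 : x / 0 <= x.
  by move=> H; have [/H//|/ltW x0] := leP 0 x;
    rewrite -sqrrN -sinN -[leRHS]sqrrN; apply: H; rewrite oppr_ge0.
have := sin_le_id x0; have := sin_le1 x; have := sin_geN1 x.
have [s0|s0] := leP 0 (sin x); first by nra.
have [x1 |x1] := leP 1 x; first by nra.
move=> _ _ _; have : 0 <= sin x; last by lra.
have p1 := @pihalf_ge1 R; apply: sin_ge0_pi; apply/andP; split; lra.
Qed.

Lemma sqr_sin_pihalf_le x : sin (pi / 2 * x) ^+ 2 <= 4 * x ^+ 2.
Proof.
apply: le_trans (sqr_sin_le _) _; rewrite exprMn ler_wpM2r ?sqr_ge0//.
have := @pihalf_lt2 R; have := @pihalf_ge1 R; nra.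
Qed.

End Trigonometry.

(** * The averaged recursion and its contraction *)

Section AveragedStep.
Context {R : realType} (m : nat) (m_gt0 : (0 < m)%N) (c : 'I_m -> int).
Implicit Types (f g : R -> R) (x y : R).

(** One step of the recursion on [tree_error], averaged over the label of the
    vertex: [f] at the left child receives the weight [cos^2], and at the right
    child the weight [sin^2] shared equally by the [m] letters. *)
Definition avg_step f x : R :=
  cos (pi / 2 * x) ^+ 2 * f (x / 4) +
  sin (pi / 2 * x) ^+ 2 * (m%:R^-1 * \sum_(i < m) f ((x - (c i)%:~R) / 4)).

(** On [0, 1[ one has [|expo x - 1|^2 <= 64 x^2] and [|expo x|^2 = 1], so this
    bounds the squared distance from [expo x] to the constants. *)
Definition base_error x : R := Num.min 1 (64 * x ^+ 2).

(** A continuous function that is positive on [-1/4, 1/4] and such that [1 - bump]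
    dominates the quadratic bound of [error_near0] below. *)
Definition bump x : R := Num.max 0 (3 / 4 - 5 * x ^+ 2).

Let m_gt0R : 0 < m%:R :> R. Proof. by rewrite ltr0n. Qed.

Lemma avg_step_le f g x :
  f (x / 4) <= g (x / 4) ->
  (forall i, f ((x - (c i)%:~R) / 4) <= g ((x - (c i)%:~R) / 4)) ->
  avg_step f x <= avg_step g x.
Proof.
move=> h0 h1; apply: lerD; rewrite ler_wpM2l ?sqr_ge0//.
by rewrite ler_wpM2l ?invr_ge0 ?ler0n//; exact: ler_sum.
Qed.

Lemma avg_step_cst (a : R) x : avg_step (fun=> a) x = a.
Proof.
rewrite /avg_step sumr_const card_ord -[a *+ m]mulr_natl mulKf ?gt_eqF//.
by rewrite -mulrDl cos2Dsin2 mul1r.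
Qed.

Lemma avg_step_affine (a : R) f x :
  avg_step (fun y => a * (1 - f y)) x = a * (1 - avg_step f x).
Proof.
rewrite /avg_step -mulr_sumr sumrB sumr_const card_ord.
have -> : 1 *+ m = m%:R :> R by [].
rewrite (cos2sin2 (pi / 2 * x)); field; exact: lt0r_neq0.
Qed.

Lemma avg_step_ge0 f x : (forall y, 0 <= f y) -> 0 <= avg_step f x.
Proof.
by move=> f0; rewrite -(avg_step_cst 0 x); apply: avg_step_le => // i.
Qed.

Lemma avg_step_continuous f : continuous f -> continuous (avg_step f).
Proof.
move=> cf.
have cpi (h : R -> R) : continuous h -> continuous (fun y => h (pi / 2 * y) ^+ 2).
  move=> ch x; apply: (@continuous_comp _ _ _ (fun y => h (pi / 2 * y)) (fun y => y ^+ 2)).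
    apply: (@continuous_comp _ _ _ (fun y => pi / 2 * y) h); last exact: ch.
    by apply: cvgM; [exact: cvg_cst|exact: cvg_id].
  exact: exprn_continuous.
have caff (b : R) : continuous (fun y => f ((y - b) / 4)).
  move=> x; apply: (@continuous_comp _ _ _ (fun y => (y - b) / 4) f); last exact: cf.
  apply: cvgM; last exact: cvg_cst.
  by apply: cvgB; [exact: cvg_id|exact: cvg_cst].
have csum : continuous (fun y => \sum_(i < m) f ((y - (c i)%:~R) / 4)).
  by apply: continuous_big => [|i _]; [exact: add_continuous|exact: caff].
move=> x; apply: cvgD.
  apply: cvgM; first exact/cpi/continuous_cos.
  by have := caff 0 x; under eq_fun do rewrite subr0.
apply: cvgM; first exact/cpi/continuous_sin.
by apply: cvgM; [exact: cvg_cst|exact: csum].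
Qed.

Lemma iter_avg_step_continuous k f :
  continuous f -> continuous (iter k avg_step f).
Proof. by move=> cf; elim: k => //= k; exact: avg_step_continuous. Qed.

Lemma bump_continuous : continuous bump.
Proof.
move=> x; apply: (@continuous_max _ _ (fun=> 0) (fun y => 3 / 4 - 5 * y ^+ 2)).
  exact: cvg_cst.
apply: cvgB; first exact: cvg_cst.
by apply: cvgM; [exact: cvg_cst|exact: exprn_continuous].
Qed.

Lemma bump_ge0 x : 0 <= bump x.
Proof. by rewrite le_max lexx. Qed.

Lemma iter_bump_ge0 k x : 0 <= iter k avg_step bump x.
Proof. by elim: k x => [|k IH] x; [exact: bump_ge0|exact: avg_step_ge0]. Qed.

Lemma bump_gt0 x : `|x| <= 1 / 4 -> 0 < bump x.
Proof.
by rewrite ler_norml => /andP[x1 x2]; rewrite lt_max; apply/orP; right; nra.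
Qed.

Let error n : R -> R := iter n avg_step base_error.

Lemma error_le1 n x : error n x <= 1.
Proof.
elim: n x => [|n IH] x; first by rewrite ge_min lexx.
by rewrite -(avg_step_cst 1 x); apply: avg_step_le.
Qed.

(** Near the origin the right child has weight [sin^2 (pi x / 2) <= 4 x^2] only,
    and the left child looks at [x / 4], where the quadratic bound is 16 times
    smaller. *)
Lemma avg_step_quadratic f (a T x : R) :
  f (x / 4) <= a * (x / 4) ^+ 2 ->
  (forall i, f ((x - (c i)%:~R) / 4) <= T) -> 0 <= a -> 0 <= T ->
  avg_step f x <= (a / 16 + 4 * T) * x ^+ 2.
Proof.
move=> f0 fT a0 T0; have s1 := sqr_sin_pihalf_le x.
have c1 : cos (pi / 2 * x) ^+ 2 <= 1 by rewrite cos2sin2 lerBlDr lerDl sqr_ge0.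
have -> : (a / 16 + 4 * T) * x ^+ 2 = a * (x / 4) ^+ 2 + (4 * x ^+ 2) * T by field.
apply: lerD.
  apply: (@le_trans _ _ (cos (pi / 2 * x) ^+ 2 * (a * (x / 4) ^+ 2))).
    by rewrite ler_wpM2l ?sqr_ge0.
  by rewrite ler_piMl// mulr_ge0 ?sqr_ge0.
apply: (@le_trans _ _ (sin (pi / 2 * x) ^+ 2 * T)); last by rewrite ler_wpM2r.
rewrite ler_wpM2l ?sqr_ge0// mulrC ler_pdivrMr//.
by rewrite mulr_natr -[in leRHS](card_ord m) -sumr_const; exact: ler_sum.
Qed.

Lemma error_le_sqr n x : error n x <= 64 * x ^+ 2.
Proof.
elim: n x => [|n IH] x; first by rewrite ge_min lexx orbT.
apply: le_trans (_ : (64 / 16 + 4 * 1) * x ^+ 2 <= _).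
  apply: avg_step_quadratic => // i; exact: error_le1.
by have := sqr_ge0 x; lra.
Qed.

Section Contraction.
Variable K : R.
Hypothesis cK : forall i, `|(c i)%:~R| <= K.

(* The interval [-K, K] is invariant under all the branches of the step. *)
Let inK0 x : `|x| <= K -> `|x / 4| <= K.
Proof. by rewrite !ler_norml => /andP[? ?]; apply/andP; split; lra. Qed.

Let inK1 i x : `|x| <= K -> `|(x - (c i)%:~R) / 4| <= K.
Proof.
have := cK i; rewrite !ler_norml => /andP[? ?] /andP[? ?].
by apply/andP; split; lra.
Qed.

(** The step is monotone and commutes with [g |-> T * (1 - g)], so a saving
    [g] on the bound [T] propagates to the saving [iter k avg_step g]. *)
Lemma iter_avg_step_affine_bound (T : R) g n1 k :
  (forall n, (n1 <= n)%N -> forall y, `|y| <= K -> error n y <= T * (1 - g y)) ->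
  forall n, (n1 + k <= n)%N -> forall y, `|y| <= K ->
    error n y <= T * (1 - iter k avg_step g y).
Proof.
move=> H; elim: k => [|k IH] [|n] nk y yK; try by apply: H => //; lia.
  by exfalso; lia.
rewrite iterS -avg_step_affine; apply: avg_step_le => [|i];
  by apply: IH; [lia|auto].
Qed.

(** Iterating [avg_step_quadratic]: the coefficient 5 is stable because
    [5 / 16 + 4 <= 5], and the initial 64 is divided by 16 at each step. *)
Lemma error_near0 (T : R) n0 : 0 <= T ->
  (forall n, (n0 <= n)%N -> forall y, `|y| <= K -> error n y <= T) ->
  forall N y, `|y| <= K ->
    error (n0 + N) y <= (64 / 16 ^+ N + 5 * T) * y ^+ 2.
Proof.
move=> T0 H; elim=> [|N IH] y yK.
  rewrite addn0 expr0; apply: le_trans (error_le_sqr _ _) _.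
  by rewrite ler_wpM2r ?sqr_ge0//; lra.
rewrite addnS; set a := 64 / 16 ^+ N + 5 * T in IH *.
have e16 : 0 < 64 / 16 ^+ N :> R by rewrite divr_gt0// exprn_gt0.
apply: le_trans (_ : (a / 16 + 4 * T) * y ^+ 2 <= _).
  apply: avg_step_quadratic => //; first exact/IH/inK0.
  - by move=> i; apply: H; [rewrite leq_addr|exact: inK1].
  - by rewrite /a; lra.
rewrite ler_wpM2r ?sqr_ge0// /a exprS invfM mulrA [64 / 16]mulrC -mulrA.
by lra.
Qed.

Lemma error_eventually_bump (T : R) n0 : 0 < T ->
  (forall n, (n0 <= n)%N -> forall y, `|y| <= K -> error n y <= T) ->
  exists n1, forall n, (n1 <= n)%N -> forall y, `|y| <= K ->
    error n y <= T * (1 - bump y).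
Proof.
move=> T0 H; have H' := error_near0 (ltW T0) H.
pose N := Num.truncn (256 * K ^+ 2 / T).
exists (n0 + N.+1)%N => n nN y yK.
have -> : n = (n0 + (n - n0))%N by lia.
have nN' : (N.+1 <= n - n0)%N by lia.
move: (n - n0)%N nN' => M NM.
have := H' M y yK; have := H (n0 + M)%N (leq_addr _ _) y yK.
rewrite /bump; set e := error _ _ => eT eq.
suff h : 64 / 16 ^+ M * y ^+ 2 <= T / 4.
  rewrite maxEle; case: ifP => _; last by rewrite subr0 mulr1.
  by move: eq h; rewrite mulrDl; move: (64 / 16 ^+ M * y ^+ 2) (y ^+ 2) => u v; lra.
have M16 : 256 * K ^+ 2 / T <= 16 ^+ M.
  apply: le_trans (ltW (truncnS_gt _)) _.
  apply: le_trans (_ : M%:R <= _); first by rewrite ler_nat.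
  by rewrite -natrX ler_nat ltnW// ltn_expl.
have y2 : y ^+ 2 <= K ^+ 2.
  rewrite -(real_normK (num_real y)) ler_sqr ?nnegrE//.
  exact: le_trans yK.
have p16 : 0 < 16 ^+ M :> R by rewrite exprn_gt0.
rewrite mulrAC ler_pdivrMr//; move: M16; rewrite ler_pdivrMr//; nra.
Qed.

Lemma avg_step_gt0_left f x : (forall y, 0 <= f y) ->
  cos (pi / 2 * x) != 0 -> 0 < f (x / 4) -> 0 < avg_step f x.
Proof.
move=> f0 cx fx; apply: ltr_pwDl.
  by rewrite mulr_gt0// exprn_even_gt0.
by apply: mulr_ge0; rewrite ?sqr_ge0// mulr_ge0 ?invr_ge0 ?ler0n ?sumr_ge0.
Qed.

Lemma avg_step_gt0_right f x i : (forall y, 0 <= f y) ->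
  sin (pi / 2 * x) != 0 -> 0 < f ((x - (c i)%:~R) / 4) -> 0 < avg_step f x.
Proof.
move=> f0 sx fx; apply: ltr_wpDl; first by rewrite mulr_ge0 ?sqr_ge0.
apply: mulr_gt0; first by rewrite exprn_even_gt0.
by apply: mulr_gt0; rewrite ?invr_gt0// (bigD1 i)//= ltr_pwDl ?sumr_ge0.
Qed.

(** Choosing the digit 0 at every step leads into the support of the bump,
    with positive probability unless an odd integer is met on the way. *)
Lemma iter_bump_gt0_straight k z : `|z| <= 4 ^+ k / 4 ->
  (forall i (n : int), z / 4 ^+ i <> (2 * n + 1)%:~R) ->
  0 < iter k avg_step bump z.
Proof.
elim: k z => [|k IH] z zk zodd; first by apply: bump_gt0; rewrite expr0 in zk.
rewrite iterS; apply: avg_step_gt0_left.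
- by move=> y; exact: iter_bump_ge0.
- apply/eqP => /cos_pihalf_eq0[n zn]; apply: (zodd 0 n).
  by rewrite expr0 divr1.
- apply: IH; last by move=> i n; rewrite -mulrA -invfM -exprS; exact: zodd.
  by rewrite normrM (ger0_norm (_ : 0 <= 4^-1))//; move: zk; rewrite exprS; lra.
Qed.

Hypothesis c_res : forall n : int, exists i (l : int), 2 * n + 1 - c i = 4 * l + 2.

(** From an odd integer the digit 0 is impossible, but some letter moves to a
    half-odd number, and no quotient of a half-odd number by a power of 4 is an
    odd integer.  This is where both residues modulo 4 must occur. *)
Lemma iter_bump_gt0 j k y : K <= 4 ^+ k / 4 -> `|y| <= K ->
  `|y| <= 4 ^+ j / 4 -> 0 < iter (j + k).+1 avg_step bump y.
Proof.
move=> Kk; have p4 i : 1 <= 4 ^+ i :> R by apply: exprn_ege1; lra.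
elim: j y => [|j IH] y yK yj.
  rewrite add0n; apply: iter_bump_gt0_straight.
    by rewrite exprS; have := p4 k; move: yj; rewrite expr0; lra.
  move=> i n e; have : `|y / 4 ^+ i| < 1.
    rewrite normrM normfV (ger0_norm (_ : 0 <= 4 ^+ i)) ?ltr_pdivrMr ?exprn_ge0 ?exprn_gt0//.
    by have := p4 i; move: yj; rewrite expr0; lra.
  by rewrite e -intr_norm -[1]/(1%:~R) ltr_int; lia.
rewrite addSn iterS; have [cy|cy] := eqVneq (cos (pi / 2 * y)) 0; last first.
  apply: avg_step_gt0_left => //; first by move=> z; exact: iter_bump_ge0.
  apply: IH; first exact: inK0.
  by rewrite normrM (ger0_norm (_ : 0 <= 4^-1))//; move: yj; rewrite exprS; lra.
(* Here y is an odd integer n, and (n - c i) / 4 = l + 1/2. *)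
have [n yn] := cos_pihalf_eq0 cy; have [i [l nl]] := c_res n.
apply: (@avg_step_gt0_right _ _ i); first by move=> z; exact: iter_bump_ge0.
  by rewrite -sqrf_eq0 sin2cos2 cy expr0n/= subr0 oner_eq0.
apply: iter_bump_gt0_straight.
  apply: le_trans (inK1 _ yK) _; apply: le_trans Kk _.
  by rewrite ler_pM2r// -addSn exprD; have := p4 j.+1; have := p4 k; nra.
move=> i' n'; rewrite yn -intrB nl -mulrA -invfM -exprS => /eqP.
have n0 : 4 ^+ i'.+1 != 0 :> R by rewrite expf_neq0.
rewrite (can2_eq (divfK n0) (mulfK n0)).
have -> : 4 ^+ i'.+1 = (4 ^+ i'.+1 : int)%:~R :> R by rewrite rmorphXn.
rewrite -intrM eqr_int => /eqP.
by rewrite exprS; move: (4 ^+ i') => u; nia.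
Qed.

(** Positivity becomes uniform by compactness of [-K, K]. *)
Lemma iter_bump_bounded_below : exists k (a : R),
  0 < a /\ forall y, `|y| <= K -> a <= iter k avg_step bump y.
Proof.
have K0 : 0 <= K.
  by have [i _] := c_res 0; exact: le_trans (normr_ge0 _) (cK i).
have [k Kk] : exists k, K <= 4 ^+ k / 4.
  pose N := Num.truncn (4 * K); exists N.+1.
  have : 4 * K <= 4 ^+ N.+1.
    apply: le_trans (ltW (truncnS_gt _)) _.
    by rewrite -natrX ler_nat ltnW// ltn_expl.
  by lra.
have KK : - K <= K by lra.
have cg : {within `[- K, K], continuous (iter (k + k).+1 avg_step bump)}.
  apply: continuous_subspaceT.
  exact/iter_avg_step_continuous/bump_continuous.
have [y yK ymin] := EVT_min KK cg.
exists (k + k).+1, (iter (k + k).+1 avg_step bump y); split.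
  have yK' : `|y| <= K by rewrite ler_norml; move: yK; rewrite in_itv.
  by apply: iter_bump_gt0 => //; exact: le_trans Kk.
by move=> z zK; apply: ymin; rewrite in_itv/= -ler_norml.
Qed.

(** The factor [1 - a] does not depend on the bound [T]: this is what allows the
    estimate to be iterated. *)
Lemma error_contracts : exists2 a : R, 0 < a <= 1 &
  forall T : R, 0 < T -> forall n0,
  (forall n, (n0 <= n)%N -> forall y, `|y| <= K -> error n y <= T) ->
  exists n1, forall n, (n1 <= n)%N -> forall y, `|y| <= K ->
    error n y <= T * (1 - a).
Proof.
have [k [a [a0 aK]]] := iter_bump_bounded_below.
have b0 : 0 < Num.min a 1 by rewrite lt_min a0/=.
exists (Num.min a 1); first by rewrite b0/= ge_min lexx orbT.
move=> T T0 n0 /(error_eventually_bump T0)[n1 H].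
exists (n1 + k)%N => n nk y yK.
apply: le_trans (iter_avg_step_affine_bound H nk yK) _.
by apply: ler_wpM2l; [exact: ltW|rewrite lerD2l lerN2 ge_min aK].
Qed.

Lemma error_eventually_small (eps : R) : 0 < eps ->
  exists n, forall y, `|y| <= K -> error n y < eps.
Proof.
move=> eps0; have [a /andP[a0 a1] H] := error_contracts.
have pow j : exists n0, forall n, (n0 <= n)%N ->
    forall y, `|y| <= K -> error n y <= (1 - a / 2) ^+ j.
  elim: j => [|j [n0 IH]]; first by exists 0 => n _ y _; rewrite expr0 error_le1.
  have T0 : 0 < (1 - a / 2) ^+ j by rewrite exprn_gt0//; lra.
  have [n1 H1] := H _ T0 _ IH; exists n1 => n n1n y yK.
  apply: le_trans (H1 n n1n y yK) _.
  by rewrite exprSr ler_pM2l//; lra.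
have : (1 - a / 2) ^+ j @[j --> \oo] --> (0 : R).
  by apply: cvg_expr; rewrite ger0_norm; lra.
move/cvgr0Pnorm_lt => /(_ _ eps0)[j _ /(_ j (leqnn j))]/= je.
have [n0 H0] := pow j; exists n0 => y yK.
by apply: le_lt_trans (H0 _ (leqnn _) y yK) _; exact: le_lt_trans (ler_norm _) je.
Qed.

End Contraction.

Theorem avg_error_to0 :
  (forall n : int, exists i (l : int), 2 * n + 1 - c i = 4 * l + 2) ->
  forall x (eps : R), 0 < eps ->
  exists n, iter n avg_step base_error x < eps.
Proof.
move=> c_res x eps eps0.
pose K := Num.max `|x| (\big[Num.max/0]_(i < m) `|(c i)%:~R|).
have cK i : `|(c i)%:~R| <= K by rewrite le_max (le_bigmax _ (fun i => `|(c i)%:~R|)) orbT.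
have [n H] := error_eventually_small cK c_res eps0.
by exists n; apply: H; rewrite le_max lexx.
Qed.

End AveragedStep.

(** * Averaging the tree recursion over the labels *)

Section TreeError.
Context {R : realType}.
Implicit Types (L : nat -> int) (s : R).

(** Vertices of the binary tree are numbered from 0 in breadth-first order, so
    that the children of [q] are [2q + 1] and [2q + 2] and the label [L q] of the
    right edge at [q] sits at position [q] of the sequence [L].  The value bounds
    the squared distance from [expo s] to the span of the exponentials read off
    the first [n] levels below [q]. *)
Fixpoint tree_error L (n q : nat) s : R :=
  if n is n'.+1 then
    cos (pi / 2 * s) ^+ 2 * tree_error L n' (2 * q + 1)%N (s / 4) +
    sin (pi / 2 * s) ^+ 2 * tree_error L n' (2 * q + 2)%N ((s - (L q)%:~R) / 4)
  else base_error s.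

Lemma tree_error_ge0 L n q s : 0 <= tree_error L n q s.
Proof.
elim: n q s => [|n IH] q s /=.
  by rewrite le_min ler01 mulr_ge0 ?sqr_ge0.
by rewrite addr_ge0// mulr_ge0 ?sqr_ge0.
Qed.

Lemma tree_error_local L L' n q s :
  (forall p, (q <= p < (q + 2) * 2 ^ n)%N -> L p = L' p) ->
  tree_error L n q s = tree_error L' n q s.
Proof.
elim: n q s => [//|n IH] q s LL' /=.
have q2 : (0 < 2 ^ n)%N by rewrite expn_gt0.
rewrite !(IH _ _ (fun p hp => LL' p _)) ?LL'//; move=> *; rewrite ?expnS; nia.
Qed.

End TreeError.

Section WordMean.
Context {R : realType} (m : nat) (a0 : 'I_m) (N : nat).
Implicit Types (u v : nat -> 'I_m) (w : {ffun 'I_N -> 'I_m}).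

Definition extend_word w (p : nat) : 'I_m :=
  if insub p is Some i then w i else a0.

Definition word_mean (F : (nat -> 'I_m) -> R) : R :=
  (m%:R ^+ N)^-1 * \sum_w F (extend_word w).

Let upd w (i : 'I_N) a : {ffun 'I_N -> 'I_m} :=
  [ffun j => if j == i then a else w j].

(** The involution that swaps the letter of [w] at [q] with [a] preserves the
    uniform measure on pairs [(w, a)], so the letter at [q] may be replaced by an
    independent one. *)
Lemma word_mean_resample (F : 'I_m -> (nat -> 'I_m) -> R) (q : nat) :
  (q < N)%N ->
  (forall a u v, (forall p, p != q -> u p = v p) -> F a u = F a v) ->
  word_mean (fun u => F (u q) u) = m%:R^-1 * \sum_a word_mean (F a).
Proof.
move=> qN Fq; pose i := Ordinal qN.
pose h (x : {ffun 'I_N -> 'I_m} * 'I_m) := (upd x.1 i x.2, x.1 i).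
have hK : involutive h.
  move=> [w a]; rewrite /h /= ffunE eqxx; congr pair.
  by apply/ffunP => j; rewrite !ffunE; case: eqP => [->|].
have extq w : extend_word w q = w i.
  by rewrite /extend_word (insubT (fun p => (p < N)%N) qN).
have m0 : m%:R != 0 :> R by rewrite pnatr_eq0; case: (m) a0 => [[]|].
rewrite /word_mean -mulr_sumr mulrCA; congr (_ * _).
apply: (canRL (mulKf m0)).
transitivity (\sum_w \sum_(a < m) F (extend_word w q) (extend_word w)).
  by rewrite mulr_sumr; apply: eq_bigr => w _; rewrite sumr_const card_ord mulr_natl.
rewrite [RHS]exchange_big/= pair_bigA/= [RHS]pair_bigA/=.
rewrite [LHS](reindex_inj (inv_inj hK)); apply: eq_bigr => -[w a] _ /=.
rewrite !extq ffunE eqxx; apply: Fq => p pq.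
rewrite /extend_word; case: insubP => // j _ jp; rewrite ffunE.
by case: eqP => // ji; rewrite -jp ji eqxx in pq.
Qed.

Lemma word_mean_linear (x y : R) F G :
  word_mean (fun u => x * F u + y * G u) = x * word_mean F + y * word_mean G.
Proof.
by rewrite /word_mean big_split/= -!mulr_sumr mulrDr !(mulrCA _^-1).
Qed.

(** The labels of the two subtrees and of the root are independent, so that
    the mean satisfies the deterministic recursion. *)
Lemma word_mean_tree_error (c : 'I_m -> int) n q s : ((q + 2) * 2 ^ n <= N)%N ->
  word_mean (fun u => tree_error (c \o u) n q s) = iter n (avg_step c) base_error s.
Proof.
have m0 : m%:R != 0 :> R by rewrite pnatr_eq0; case: (m) a0 => [[]|].
elim: n q s => [|n IH] q s qN.
  rewrite /word_mean /= sumr_const card_ffun !card_ord -[X in _ * X]mulr_natl.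
  by rewrite natrX mulKf// expf_neq0.
have q2 : (0 < 2 ^ n)%N by rewrite expn_gt0.
move: qN; rewrite expnS => qN /=; rewrite word_mean_linear IH; last by nia.
congr (_ + _ * _).
rewrite (word_mean_resample (F := fun a u => tree_error (c \o u) n (2 * q + 2) ((s - (c a)%:~R) / 4)) (q := q)).
- by congr (_ * _); apply: eq_bigr => i _; apply: IH; nia.
- by nia.
- move=> a u v uv; apply: tree_error_local => p /andP[qp _] /=.
  by rewrite uv//; apply/eqP; lia.
Qed.

End WordMean.

(** * Random labels *)

Section LocalEvents.
Context (A : choiceType) (a0 : A).

(** Prescribing finitely many letters defines a neighbourhood in the product of
    the discrete topologies, so such events are open. *)
Lemma measurable_local_event (N : nat) (S : set (nat -> A)) :
  (forall u v, (forall p, (p < N)%N -> u p = v p) -> S u -> S v) ->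
  measurable (S : set (borel_words a0)).
Proof.
move=> Sloc; apply: sub_sigma_algebra.
rewrite /= openE => u Su.
have nbu n : nbhs (u : words a0) [set v | forall p, (p < n)%N -> v p = u p].
  elim: n => [|n IH]; first by apply: filterS filterT => v _ p.
  have un : nbhs (u : words a0) [set v | v n = u n].
    have /= := @proj_continuous _ (fun=> discrete_topology A) n u [set u n].
    by apply; exact: discrete_set1.
  apply: filterS (filterI IH un) => v [h1 h2] p.
  by rewrite ltnS leq_eqVlt => /predU1P[->//|]; exact: h1.
by apply: filterS (nbu N) => v uv; apply: Sloc Su => p pN; rewrite uv.
Qed.

End LocalEvents.

Section RandomLabels.
Context {R : realType} (m : nat) (hm : (2 <= m)%N).
Variable mut : probability (borel_words (letter0 hm)) R.
Hypothesis hmut : forall w : seq 'I_m,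
  mut (cylinder w) = ((m%:R ^+ size w)^-1)%:E.

Local Notation ext := (extend_word (letter0 hm)).

Lemma measurable_cylinder (w : seq 'I_m) :
  measurable (cylinder w : set (borel_words (letter0 hm))).
Proof.
apply: (@measurable_local_event _ _ (size w)) => u v uv.
rewrite /cylinder /mkset => <-; rewrite size_mkseq; apply/eq_in_map => p.
by rewrite mem_iota add0n => /andP[_ pw]; rewrite uv.
Qed.

(** Markov's inequality; the event is covered by the cylinders of the words on
    which [F] is large. *)
Lemma word_markov N (F : (nat -> 'I_m) -> R) (eps : R) :
  0 < eps -> (forall u, 0 <= F u) ->
  (forall u v, (forall p, (p < N)%N -> u p = v p) -> F u = F v) ->
  (mut [set u | (eps <= F u)%R] <= (word_mean (letter0 hm) N F / eps)%:E)%E.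
Proof.
move=> eps0 F0 Floc.
have cylE (u : nat -> 'I_m) (w : {ffun 'I_N -> 'I_m}) :
    cylinder (mkseq (ext w) N) u -> F u = F (ext w).
  rewrite /cylinder /mkset size_mkseq => e; apply: Floc => p pN.
  by have := congr1 (fun s => nth (letter0 hm) s p) e; rewrite !nth_mkseq.
pose U := \big[setU/set0]_(w : {ffun 'I_N -> 'I_m} | eps <= F (ext w))
   (cylinder (mkseq (ext w) N) : set (borel_words (letter0 hm))).
have mU : measurable U.
  by apply: bigsetU_measurable => w _; exact: measurable_cylinder.
have mE : measurable ([set u | eps <= F u] : set (borel_words (letter0 hm))).
  by apply: (@measurable_local_event _ _ N) => u v uv /=; rewrite (Floc u v).
apply: (@le_trans _ _ (mut U)).
  apply: le_measure; rewrite ?inE// => u /= epsu.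
  pose w : {ffun 'I_N -> 'I_m} := [ffun i => u (val i)].
  have uw p : (p < N)%N -> ext w p = u p.
    by move=> pN; rewrite /extend_word (insubT (fun p => (p < N)%N) pN) ffunE.
  rewrite /U -bigcup_seq_cond /=; exists w => /=.
    by rewrite mem_index_enum/= (Floc _ u).
  rewrite /cylinder /mkset size_mkseq; apply/eq_in_map => p.
  by rewrite mem_iota add0n => /andP[_ pw]; rewrite uw.
apply: (@le_trans _ _ (\sum_(w : {ffun 'I_N -> 'I_m} | (eps <= F (ext w))%R)
    mut (cylinder (mkseq (ext w) N) : set (borel_words (letter0 hm))))%E).
  have [] // : measurable U /\ (mut U <= \sum_(w : {ffun 'I_N -> 'I_m} | (eps <= F (ext w))%R)
      mut (cylinder (mkseq (ext w) N) : set (borel_words (letter0 hm))))%E.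
  apply: (big_ind2 (fun (B : set (borel_words (letter0 hm))) x =>
    measurable B /\ (mut B <= x)%E)).
  - by rewrite measure0.
  - move=> B1 x1 B2 x2 [m1 h1] [m2 h2]; split; first exact: measurableU.
    by apply: le_trans (measureU2 _ m1 m2) _; exact: leeD.
  - by move=> w _; split=> //; exact: measurable_cylinder.
rewrite (eq_bigr (fun w => ((m%:R ^+ N)^-1)%:E)); last first.
  by move=> w _; rewrite hmut size_mkseq.
rewrite sumEFin lee_fin ler_pdivlMr// /word_mean mulr_suml mulr_sumr.
rewrite [leRHS](bigID (fun w => eps <= F (ext w)))/= -[leLHS]addr0.
apply: lerD.
  by apply: ler_sum => w ew; rewrite ler_wpM2l// invr_ge0 exprn_ge0 ?ler0n.
by apply: sumr_ge0 => w _; rewrite mulr_ge0// invr_ge0 exprn_ge0 ?ler0n.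
Qed.

Section AlmostSure.
Context (C : {fset int}) (c : 'I_m -> C).
Hypothesis c_res : forall n : int,
  exists i (l : int), 2 * n + 1 - val (c i) = 4 * l + 2.

(** The mean of the [n]-th error becomes arbitrarily small, so by Markov's
    inequality the errors exceed [eps] for all [n] with probability 0. *)
Lemma word_map_never_small q s (eps : R) : 0 < eps ->
  let S := word_map (letter0 hm) c @^-1`
    [set L : nat -> C | forall n, eps <= tree_error (fun p => val (L p)) n q s] in
  measurable S /\ mut S = 0%E.
Proof.
move=> eps0 S.
pose e u n : R := tree_error ((val \o c) \o u) n q s.
have eloc n u v : (forall p, (p < (q + 2) * 2 ^ n)%N -> u p = v p) -> e u n = e v n.
  by move=> uv; apply: tree_error_local => p /andP[_ pq] /=; rewrite uv.
have mE n : measurable ([set u | eps <= e u n] : set (borel_words (letter0 hm))).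
  apply: (@measurable_local_event _ _ ((q + 2) * 2 ^ n)) => u v uv /=.
  by rewrite (eloc n u v).
have SE : S = \bigcap_n [set u | eps <= e u n].
  by apply/seteqP; split => u /= h; [move=> k _; exact: h|move=> k; exact: (h k I)].
have mS : measurable S by rewrite SE; exact: bigcapT_measurable.
split=> //; apply/eqP; rewrite -measure_le0.
apply/lee_addgt0Pr => d d0; rewrite add0e.
have ed0 : 0 < eps * d by rewrite mulr_gt0.
have [n hn] := @avg_error_to0 R m (ltnW hm) (val \o c) c_res s _ ed0.
apply: (@le_trans _ _ (mut [set u | eps <= e u n])).
  by apply: le_measure; rewrite ?inE// SE => u /(_ n I).
apply: le_trans (word_markov eps0 _ (eloc n)) _.
  by move=> u; exact: tree_error_ge0.
rewrite (word_mean_tree_error _ _ _ (leqnn _)) lee_fin ler_pdivrMr// mulrC.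
exact: ltW.
Qed.

(** Rational frequencies suffice for the density argument, and they leave only
    countably many null sets to discard. *)
Lemma ae_tree_error_small :
  {ae pushforward mut (word_map (letter0 hm) c), forall L : nat -> C,
    forall q (s : rat) (eps : R), 0 < eps ->
      exists n, tree_error (fun p => val (L p)) n q (ratr s) < eps}.
Proof.
pose B (x : nat * rat * nat) := [set L : nat -> C |
  forall n, x.2.+1%:R^-1 <= tree_error (fun p => val (L p)) n x.1.1 (ratr x.1.2) :> R].
have mB x : measurable (B x : set (borel_words (c (letter0 hm)))).
  have -> : B x = \bigcap_n [set L : nat -> C | x.2.+1%:R^-1 <=
      tree_error (fun p => val (L p)) n x.1.1 (ratr x.1.2) :> R].
    by apply/seteqP; split => u /= h; [move=> k _; exact: h|move=> k; exact: (h k I)].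
  apply: bigcapT_measurable => n.
  apply: (@measurable_local_event _ _ ((x.1.1 + 2) * 2 ^ n)) => u v uv /=.
  rewrite (@tree_error_local _ _ (fun p => val (v p)))// => p /andP[_ pq].
  by rewrite uv.
pose B' i := if @choice.unpickle (nat * rat * nat)%type i is Some x then B x else set0.
have mB' i : measurable (B' i : set (borel_words (c (letter0 hm)))).
  by rewrite /B'; case: choice.unpickle.
exists (\bigcup_i B' i); split.
- exact: bigcupT_measurable.
- have mPB i : measurable (word_map (letter0 hm) c @^-1` B' i) /\
      mut (word_map (letter0 hm) c @^-1` B' i) = 0%E.
    rewrite /B'; case: choice.unpickle => [[[q s] k]|].
      by apply: word_map_never_small; rewrite invr_gt0.
    by rewrite preimage_set0 measure0; split=> //; exact: measurable0.
  rewrite /pushforward preimage_bigcup; apply/negligibleP.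
    by apply: bigcupT_measurable => i; have [] := mPB i.
  by apply: negligible_bigcup => i; have [mi mi0] := mPB i; apply/negligibleP.
- move=> L /= nL; apply: contrapT => LB; apply: nL => q s eps eps0.
  apply: contrapT => h; apply: LB.
  exists (choice.pickle (q, s, Num.truncn eps^-1)) => //.
  rewrite /B' choice.pickleK => n /=; apply: (@le_trans _ _ eps).
    by rewrite -[leRHS]invrK lef_pV2 ?posrE ?invr_gt0// ltW// truncnS_gt.
  by rewrite leNgt; apply/negP => hn; apply: h; exists n.
Qed.

End AlmostSure.
End RandomLabels.

(** * Square-integrable complex functions *)

Section ComplexFunctions.
Context {R : realType}.
Implicit Types (z : R[i]) (x y s t : R).

Definition normsq z : R := complex.Re z ^+ 2 + complex.Im z ^+ 2.

Lemma normsq_ge0 z : 0 <= normsq z.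
Proof. by rewrite addr_ge0 ?sqr_ge0. Qed.

Lemma normcX2 z : Normc.normc z ^+ 2 = normsq z.
Proof. by case: z => a b /=; rewrite sqr_sqrtr ?addr_ge0 ?sqr_ge0. Qed.

Lemma normsqM z1 z2 : normsq (z1 * z2) = normsq z1 * normsq z2.
Proof. by case: z1 => a b; case: z2 => u v; rewrite /normsq /=; ring. Qed.

Lemma parallelogram z1 z2 :
  normsq (z1 + z2) + normsq (z1 - z2) = 2 * normsq z1 + 2 * normsq z2.
Proof. by case: z1 => a b; case: z2 => u v; rewrite /normsq /=; ring. Qed.

Lemma normsqD_le z1 z2 : normsq (z1 + z2) <= 2 * normsq z1 + 2 * normsq z2.
Proof. by rewrite -parallelogram lerDl normsq_ge0. Qed.

Lemma expoD s t x : expo (s + t) x = expo s x * expo t x.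
Proof.
rewrite /expo [in LHS](_ : 2 * pi * (s + t) * x = 2 * pi * s * x + 2 * pi * t * x).
  by rewrite cosD sinD; apply/eqP; rewrite eq_complex /= eqxx/= addrC.
by ring.
Qed.

Lemma expoDr s x y : expo s (x + y) = expo s x * expo s y.
Proof. by rewrite /expo mulrDr cosD sinD; apply/eqP; rewrite eq_complex /= eqxx/= addrC. Qed.

Lemma expo0 x : expo 0 x = 1.
Proof. by rewrite /expo mulr0 mul0r cos0 sin0. Qed.

Lemma expo_mulr (a s x : R) : expo s (a * x) = expo (a * s) x.
Proof. by rewrite /expo; congr Complex; [congr cos|congr sin]; ring. Qed.

Lemma normsq_expo s x : normsq (expo s x) = 1.
Proof. by rewrite /normsq /= cos2Dsin2. Qed.

Lemma expo_int (n k : int) : expo (n%:~R : R) k%:~R = 1.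
Proof.
have e : 2 * pi * n%:~R * k%:~R = 0 + 2 * pi * (n * k)%:~R :> R.
  by rewrite intrM; ring.
by rewrite /expo e cosD2piz sinD2piz cos0 sin0.
Qed.

Lemma expo_odd_half (n : int) : expo ((2 * n + 1)%:~R : R) 2^-1 = -1.
Proof.
have e : 2 * pi * (2 * n + 1)%:~R * 2^-1 = 0 + pi * (2 * n + 1)%:~R :> R by field.
rewrite /expo e cosDpi_odd sinDpi_odd cos0 sin0 oppr0.
by apply/eqP; rewrite eq_complex /= oppr0 !eqxx.
Qed.

(** On the second half of the Cantor set [expo s] picks up the factor
    [expo s (1/2)].  The half sum and the half difference of the factors 1 and
    [expo s (1/2)] split it between the left and the right subtree, and their
    squared moduli are the weights of the recursion. *)
Lemma normsq_half_sum s :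
  normsq (2^-1 * (1 + expo s 2^-1)) = cos (pi / 2 * s) ^+ 2.
Proof.
have e : 2 * pi * s * 2^-1 = (pi / 2 * s) *+ 2 :> R by rewrite mulr2n; field.
have -> : 2^-1 = (2^-1)%:C%C :> R[i] by rewrite fmorphV rmorph_nat.
rewrite /expo e cos_mulr2n sin_mulr2n /normsq /=.
have := cos2Dsin2 (pi / 2 * s); move: (cos _) (sin _) => a b ab.
rewrite !mul0r; transitivity (a ^+ 2 * (a ^+ 2 + b ^+ 2)); last by rewrite ab mulr1.
by rewrite !mulr2n; field.
Qed.

Lemma normsq_half_diff s :
  normsq (2^-1 * (1 - expo s 2^-1)) = sin (pi / 2 * s) ^+ 2.
Proof.
have e : 2 * pi * s * 2^-1 = (pi / 2 * s) *+ 2 :> R by rewrite mulr2n; field.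
have -> : 2^-1 = (2^-1)%:C%C :> R[i] by rewrite fmorphV rmorph_nat.
rewrite /expo e cos_mulr2n sin_mulr2n /normsq /=.
have := cos2Dsin2 (pi / 2 * s); move: (cos _) (sin _) => a b ab.
have b2 : b ^+ 2 = 1 - a ^+ 2 by rewrite -ab; ring.
rewrite !mul0r; transitivity ((1 - a ^+ 2) ^+ 2 + a ^+ 2 * b ^+ 2).
  by rewrite !mulr2n; field.
by rewrite b2; ring.
Qed.

End ComplexFunctions.

Section SquareIntegral.
Context {d : measure_display} {T : measurableType d} {R : realType}.
Variable mu : {measure set T -> \bar R}.
Implicit Types f g : T -> R[i].

Definition cmeasurable f :=
  measurable_fun setT (fun x => complex.Re (f x)) /\
  measurable_fun setT (fun x => complex.Im (f x)).

Definition sqint f : \bar R := (\int[mu]_x (normsq (f x))%:E)%E.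

Lemma cmeasurable_cst z : cmeasurable (fun=> z).
Proof. by split; exact: measurable_cst. Qed.

Lemma cmeasurableD f g : cmeasurable f -> cmeasurable g ->
  cmeasurable (fun x => f x + g x).
Proof.
move=> [f1 f2] [g1 g2]; split.
  rewrite (_ : (fun x => _) = (fun x => complex.Re (f x) + complex.Re (g x))); last first.
    by apply/funext => x; case: (f x) (g x) => ? ? [].
  exact: measurable_funD.
rewrite (_ : (fun x => _) = (fun x => complex.Im (f x) + complex.Im (g x))); last first.
  by apply/funext => x; case: (f x) (g x) => ? ? [].
exact: measurable_funD.
Qed.

Lemma cmeasurableM f g : cmeasurable f -> cmeasurable g ->
  cmeasurable (fun x => f x * g x).
Proof.
move=> [f1 f2] [g1 g2]; split.
  rewrite (_ : (fun x => _) = (fun x => complex.Re (f x) * complex.Re (g x)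
      - complex.Im (f x) * complex.Im (g x))); last first.
    by apply/funext => x; case: (f x) (g x) => ? ? [].
  by apply: measurable_funB; exact: measurable_funM.
rewrite (_ : (fun x => _) = (fun x => complex.Re (f x) * complex.Im (g x)
    + complex.Im (f x) * complex.Re (g x))); last first.
  by apply/funext => x; case: (f x) (g x) => ? ? [].
by apply: measurable_funD; exact: measurable_funM.
Qed.

Lemma cmeasurableZ z f : cmeasurable f -> cmeasurable (fun x => z * f x).
Proof. by move=> mf; apply: cmeasurableM => //; exact: cmeasurable_cst. Qed.

Lemma cmeasurableB f g : cmeasurable f -> cmeasurable g ->
  cmeasurable (fun x => f x - g x).
Proof.
move=> mf mg; under eq_fun do rewrite -mulN1r.
by apply: cmeasurableD => //; exact: cmeasurableZ.
Qed.

Lemma cmeasurable_sum I (s : seq I) (F : I -> T -> R[i]) :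
  (forall i, cmeasurable (F i)) -> cmeasurable (fun x => \sum_(i <- s) F i x).
Proof.
move=> mF; elim: s => [|i s IH].
  by under eq_fun do rewrite big_nil; exact: cmeasurable_cst.
by under eq_fun do rewrite big_cons; exact: cmeasurableD.
Qed.

Lemma cmeasurable_real (h : T -> R) : measurable_fun setT h ->
  cmeasurable (fun x => (h x)%:C%C).
Proof. by move=> mh; split => //=; exact: measurable_cst. Qed.

Lemma measurable_normsq f : cmeasurable f ->
  measurable_fun setT (fun x => (normsq (f x))%:E).
Proof.
move=> [f1 f2]; apply/measurable_EFinP.
by apply: measurable_funD; exact: measurable_funX.
Qed.

Lemma sqint_ge0 f : (0 <= sqint f)%E.
Proof. by apply: integral_ge0 => x _; rewrite lee_fin normsq_ge0. Qed.

Lemma sqint_ext f g : f =1 g -> sqint f = sqint g.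
Proof. by move=> fg; apply: eq_integral => x _; rewrite fg. Qed.

Lemma sqint0 : sqint (fun=> 0) = 0%E.
Proof.
by rewrite /sqint /normsq /= expr0n addr0; apply: integral0_eq => x _.
Qed.

Lemma sqintZ z f : cmeasurable f ->
  sqint (fun x => z * f x)%R = ((normsq z)%:E * sqint f)%E.
Proof.
move=> mf; rewrite /sqint; under eq_integral do rewrite normsqM EFinM.
rewrite ge0_integralZl//; first exact: measurable_normsq.
  by move=> x _; rewrite lee_fin normsq_ge0.
by rewrite lee_fin normsq_ge0.
Qed.

Lemma sqintD_le f g : cmeasurable f -> cmeasurable g ->
  (sqint (fun x => f x + g x)%R <= 2%:E * sqint f + 2%:E * sqint g)%E.
Proof.
move=> mf mg.
have mfg := measurable_normsq (cmeasurableD mf mg).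
have nf x : (0 <= (normsq (f x))%:E)%E by rewrite lee_fin normsq_ge0.
have ng x : (0 <= (normsq (g x))%:E)%E by rewrite lee_fin normsq_ge0.
have mf' := measurable_normsq mf; have mg' := measurable_normsq mg.
rewrite /sqint -!ge0_integralZl// -ge0_integralD//=.
- apply: ge0_le_integral => //=.
  + by move=> x _; rewrite lee_fin normsq_ge0.
  + by apply: emeasurable_funD; apply: measurable_funeM.
  + by move=> x _; rewrite -!EFinM -EFinD lee_fin; exact: normsqD_le.
- by move=> x _; rewrite mule_ge0.
- exact: measurable_funeM.
- by move=> x _; rewrite mule_ge0.
- exact: measurable_funeM.
Qed.

Lemma sqint_parallelogram f g : cmeasurable f -> cmeasurable g ->
  (2^-1%:E * sqint (fun x => f x + g x)%R + 2^-1%:E * sqint (fun x => f x - g x)%R =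
   sqint f + sqint g)%E.
Proof.
move=> mf mg.
have mD := measurable_normsq (cmeasurableD mf mg).
have mB := measurable_normsq (cmeasurableB mf mg).
have mf' := measurable_normsq mf; have mg' := measurable_normsq mg.
have h0 : (0 <= (2^-1)%:E :> \bar R)%E by rewrite lee_fin.
have n0 (h : T -> R[i]) x : (0 <= (normsq (h x))%:E)%E by rewrite lee_fin normsq_ge0.
have half h : measurable_fun setT (fun x : T => (normsq (h x))%:E) ->
    (2^-1%:E * \int[mu]_x (normsq (h x))%:E = \int[mu]_x (2^-1%:E * (normsq (h x))%:E))%E.
  by move=> mh; rewrite ge0_integralZl.
rewrite /sqint !half//.
rewrite -!ge0_integralD//=.
- apply: eq_integral => x _; rewrite -!EFinM -!EFinD; congr EFin.
  rewrite -mulrDr parallelogram -mulrDr mulrA mulVf ?mul1r//.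
- by move=> x _; rewrite mule_ge0// lee_fin normsq_ge0.
- exact: measurable_funeM.
- by move=> x _; rewrite mule_ge0// lee_fin normsq_ge0.
- exact: measurable_funeM.
Qed.

Lemma cnorm2_lt f (eps : R) : 0 < eps ->
  (sqint f < (eps ^+ 2)%:E)%E -> (cnorm2 mu f < eps%:E)%E.
Proof.
move=> eps0 h; rewrite /cnorm2 unlock.
under eq_integral => x _.
  rewrite /= ger0_norm; last by case: (f x) => a b /=; exact: sqrtr_ge0.
  rewrite powR_mulrn; last by case: (f x) => a b /=; exact: sqrtr_ge0.
  rewrite normcX2; over.
rewrite -/(sqint f).
have := sqint_ge0 f; case: (sqint f) h => [r| |]//.
rewrite lte_fin lee_fin => re r0; rewrite poweR_EFin lte_fin.
have -> : eps = Num.sqrt (eps ^+ 2) by rewrite sqrtr_sqr ger0_norm// ltW.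
by rewrite powR12_sqrt// ltr_sqrt ?exprn_gt0.
Qed.

Lemma complexL2_sqint f : complexL2 mu f -> cmeasurable f /\ (sqint f < +oo)%E.
Proof.
move=> [f1 f2]; rewrite /cnorm2 unlock => h; split=> //.
move: h; under eq_integral => x _.
  rewrite /= ger0_norm; last by case: (f x) => a b /=; exact: sqrtr_ge0.
  rewrite powR_mulrn; last by case: (f x) => a b /=; exact: sqrtr_ge0.
  rewrite normcX2; over.
rewrite -/(sqint f); have := sqint_ge0 f; case: (sqint f) => [r _ _| |]//.
- exact: ltry.
- by rewrite poweRyr ?invr_eq0.
Qed.

End SquareIntegral.

Section BoundedIntegral.
Context {d : measure_display} {T : measurableType d} {R : realType}.
Variable P : probability T R.

Lemma bounded_integrable (h : T -> R) (M : R) :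
  measurable_fun setT h -> (forall x, `|h x| <= M) -> P.-integrable setT (EFin \o h).
Proof.
move=> mh hM; apply: measurable_bounded_integrable => //.
  exact: fin_num_fun_lty.
by exists M; split=> [|N MN x _]; [exact: num_real|exact: le_trans (ltW MN)].
Qed.

Lemma integral_bounded_shift (h : T -> R) (M : R) :
  measurable_fun setT h -> (forall x, `|h x| <= M) ->
  (\int[P]_x (h x + M)%:E = (\int[P]_x h x + M)%:E)%E.
Proof.
move=> mh hM; have ih := bounded_integrable mh hM.
have iM : P.-integrable setT (EFin \o cst M).
  exact: (@bounded_integrable _ `|M|).
have := RintegralD measurableT ih iM.
have P1 : fine (P setT) = 1 by exact: (congr1 fine (probability_setT P)).
rewrite Rintegral_cst// P1 mulr1 => <-.
rewrite /Rintegral fineK//; apply: integrable_fin_num => //.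
exact: (integrableD _ ih iM).
Qed.

End BoundedIntegral.

(** * The middle-fourth Cantor measure *)

Section CantorMeasure.
Context {R : realType}.
Variable mu4 : probability (measurableTypeR R) R.
Hypothesis hmu4 : middle_fourth_Cantor mu4.

Local Notation T := (measurableTypeR R).

Lemma measurable_tau1 : measurable_fun setT (tau1 : T -> T).
Proof. exact: measurable_funM. Qed.

Lemma measurable_tau2 : measurable_fun setT (tau2 : T -> T).
Proof. by apply: measurable_funM => //; exact: measurable_funD. Qed.

Lemma pushforward_is_measure (phi : T -> T) : measurable_fun setT phi ->
  exists m : {measure set T -> \bar R}, (m : set T -> \bar R) = pushforward mu4 phi.
Proof. by move=> mphi; unshelve eexists (pushforward mu4 phi). Qed.

Local Open Scope ereal_scope.

Lemma cantor_measure_sum : exists m1 m2 : {measure set T -> \bar R},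
  [/\ (m1 : set T -> \bar R) = pushforward mu4 tau1,
      (m2 : set T -> \bar R) = pushforward mu4 tau2 &
      forall A, measurable A ->
        mu4 A = measure_add (mscale (2^-1)%:nng%R m1) (mscale (2^-1)%:nng%R m2) A].
Proof.
have [m1 m1E] := pushforward_is_measure measurable_tau1.
have [m2 m2E] := pushforward_is_measure measurable_tau2.
exists m1, m2; split=> // A mA; rewrite hmu4// measure_addE.
transitivity (2^-1%:E * m1 A + 2^-1%:E * m2 A); last by [].
by rewrite m1E m2E.
Qed.

Lemma ge0_integral_cantor (f : T -> \bar R) :
  measurable_fun setT f -> (forall x, 0 <= f x) ->
  \int[mu4]_x f x =
    2^-1%:E * \int[mu4]_x f (tau1 x) + 2^-1%:E * \int[mu4]_x f (tau2 x).
Proof.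
move=> mf f0; have [m1 [m2 [m1E m2E muE]]] := cantor_measure_sum.
rewrite (eq_measure_integral _ (fun A mA _ => muE A mA)).
rewrite ge0_integral_measure_add// !ge0_integral_mscale//= m1E m2E.
rewrite !ge0_integral_pushforward//; last 2 first.
  exact: measurable_tau2.
  exact: measurable_tau1.
Qed.

Local Close Scope ereal_scope.

Lemma Rintegral_cantor (h : T -> R) (M : R) :
  measurable_fun setT h -> (forall x, `|h x| <= M) ->
  \int[mu4]_x h x =
    2^-1 * \int[mu4]_x h (tau1 x) + 2^-1 * \int[mu4]_x h (tau2 x).
Proof.
move=> mh hM.
have m1 := measurableT_comp mh measurable_tau1.
have m2 := measurableT_comp mh measurable_tau2.
have : (\int[mu4]_x (h x + M)%:E = 2^-1%:E * \int[mu4]_x (h (tau1 x) + M)%:E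
    + 2^-1%:E * \int[mu4]_x (h (tau2 x) + M)%:E)%E.
  apply: ge0_integral_cantor.
    by apply/measurable_EFinP; exact: measurable_funD.
  by move=> x; rewrite lee_fin -lerBlDr sub0r; have := hM x; rewrite ler_norml => /andP[].
rewrite !(@integral_bounded_shift _ _ _ mu4 _ M)// -!EFinM -EFinD => -[]; lra.
Qed.

(** The preimages under [tau1] and [tau2] of the complement of [-r, 1 + r[ lie in
    the complement of [-4r, 1 + 4r[, so the mass outside [0, 1[ could only sit at
    infinity. *)
Lemma cantor_ae_unit : mu4 [set x | x < 0 \/ 1 <= x] = 0%E.
Proof.
pose S (r : R) : set T := [set x | x < - r \/ 1 + r <= x].
have mS r : measurable (S r).
  have -> : S r = `]-oo, (- r)[%classic `|` `[1 + r, +oo[%classic.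
    by apply/seteqP; split => x /=; rewrite !in_itv/= andbT.
  by apply: measurableU; exact: measurable_itv.
have -> : [set x | x < 0 \/ 1 <= x] = S 0.
  by rewrite /S oppr0 addr0.
pose v r := fine (mu4 (S r)).
have vE r : mu4 (S r) = (v r)%:E by rewrite /v fineK// fin_num_measure.
have v_le r r1 r2 : tau1 @^-1` S r `<=` S r1 -> tau2 @^-1` S r `<=` S r2 ->
    v r <= 2^-1 * v r1 + 2^-1 * v r2.
  move=> s1 s2; rewrite -lee_fin EFinD !EFinM -!vE hmu4//.
  have m1 : measurable (tau1 @^-1` S r : set T).
    by rewrite -[X in measurable X]setTI; exact: measurable_tau1.
  have m2 : measurable (tau2 @^-1` S r : set T).
    by rewrite -[X in measurable X]setTI; exact: measurable_tau2.
  by apply: leeD; apply: lee_pmul => //; apply: le_measure => //; rewrite inE.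
(* For r = 0 the factor 4 gains nothing, but the preimage under tau2 of the
   complement of [0, 1[ avoids [-1, 2[. *)
have S0 : v 0 <= v 1.
  have : v 0 <= 2^-1 * v 0 + 2^-1 * v 1; last by lra.
  by apply: v_le => x; rewrite /S /tau1 /tau2 /=; lra.
have S4 r : 0 <= r -> v r <= v (4 * r).
  move=> r0; have : v r <= 2^-1 * v (4 * r) + 2^-1 * v (4 * r); last by lra.
  by apply: v_le => x; rewrite /S /tau1 /tau2 /=; lra.
have S4n n : v 0 <= v (4 ^+ n).
  elim: n => [|n IH]; first by rewrite expr0.
  by apply: le_trans IH _; rewrite exprS; apply: S4; rewrite exprn_ge0.
have cap : \bigcap_n S (4 ^+ n) = set0.
  apply/seteqP; split => // x /= xS.
  have := xS (Num.truncn `|x|).+1 I; rewrite /S /=.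
  have : `|x| < 4 ^+ (Num.truncn `|x|).+1.
    apply: lt_le_trans (truncnS_gt _) _.
    by rewrite -natrX ler_nat ltnW// ltn_expl.
  by rewrite ltr_norml => /andP[]; lra.
have := @nonincreasing_cvg_mu _ _ _ mu4 (fun n => S (4 ^+ n)).
rewrite cap measure0 => /(_ _ _ _ _)/(cvge_ge _) h.
apply/eqP; rewrite -measure_le0; apply: h => //.
- apply: nearW => n; have := S4n n; rewrite -lee_fin -!vE; exact.
- have := ltry (v (4 ^+ 0)); rewrite -vE; exact.
- move=> n m nm; apply/subsetPset => x; rewrite /S /=.
  have : 4 ^+ n <= 4 ^+ m :> R by rewrite ler_weXn2l//; lra.
  by lra.
Qed.

Lemma cantor_ae (Q : T -> Prop) : (forall x : R, 0 <= x < 1 -> Q x) ->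
  {ae mu4, forall x, setT x -> Q x}.
Proof.
move=> QI; exists [set x : R | x < 0 \/ 1 <= x]; split.
- have -> : [set x : R | x < 0 \/ 1 <= x] = `]-oo, 0[%classic `|` `[1, +oo[%classic.
    by apply/seteqP; split => x /=; rewrite !in_itv/= andbT.
  by apply: measurableU; exact: measurable_itv.
- exact: cantor_ae_unit.
- move=> x /= nx; apply: contrapT => h; apply: nx => _.
  apply: QI; move: h => /not_orP[/negP + /negP].
  by rewrite -leNgt -ltNge => -> ->.
Qed.

Lemma sqint_cantor (f : T -> R[i]) : cmeasurable f ->
  sqint mu4 f = (2^-1%:E * sqint mu4 (f \o tau1) + 2^-1%:E * sqint mu4 (f \o tau2))%E.
Proof.
move=> mf; rewrite /sqint (ge0_integral_cantor (measurable_normsq mf))// => x.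
by rewrite lee_fin normsq_ge0.
Qed.

Lemma cmeasurable_expo s : cmeasurable (expo s : T -> R[i]).
Proof.
split => /=; apply: measurableT_comp => //.
- by apply: continuous_measurable_fun; exact: continuous_cos.
- by apply: continuous_measurable_fun; exact: continuous_sin.
Qed.

End CantorMeasure.

(** * Approximation by exponentials along a labelled tree *)

Section TreeApproximation.
Context {R : realType}.
Variable mu4 : probability (measurableTypeR R) R.
Hypothesis hmu4 : middle_fourth_Cantor mu4.

Local Notation T := (measurableTypeR R).
Local Notation sq := (sqint mu4).
Implicit Types (L : nat -> int) (l : seq (R[i] * seq bool)) (f g : T -> R[i]).

(** The frequency reached from the vertex [q] by the branch [b], where [true]
    means that the labelled right edge is taken. *)
Fixpoint tree_value L q (b : seq bool) : int :=
  match b with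
  | [::] => 0
  | false :: b' => 4 * tree_value L (2 * q + 1)%N b'
  | true :: b' => L q + 4 * tree_value L (2 * q + 2)%N b'
  end.

Definition tree_poly L q l (x : T) : R[i] :=
  \sum_(p <- l) p.1 * expo (tree_value L q p.2)%:~R x.

Definition tree_poly_join (l0 l1 : seq (R[i] * seq bool)) :=
  [seq (p.1, false :: p.2) | p <- l0] ++ [seq (p.1, true :: p.2) | p <- l1].

Lemma tree_poly_joinE L q l0 l1 (x : R) :
  tree_poly L q (tree_poly_join l0 l1) x =
  tree_poly L (2 * q + 1) l0 (4 * x) +
  expo (L q)%:~R x * tree_poly L (2 * q + 2) l1 (4 * x).
Proof.
rewrite /tree_poly big_cat !big_map mulr_sumr /=; congr (_ + _).
  by apply: eq_bigr => p _; rewrite intrM expo_mulr.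
by apply: eq_bigr => p _; rewrite intrD intrM expo_mulr expoD mulrCA.
Qed.

(** Frequencies are integers; hence the translation by 2 in [tau2], after scaling
    by 4, is invisible. *)
Lemma tree_polyD2 L q l (x : R) : tree_poly L q l (x + 2) = tree_poly L q l x.
Proof.
apply: eq_bigr => p _; rewrite expoDr -[2]/(2%:~R).
by rewrite expo_int mulr1.
Qed.

Lemma tree_polyZ L q z l (x : R) :
  tree_poly L q [seq (z * p.1, p.2) | p <- l] x = z * tree_poly L q l x.
Proof.
by rewrite /tree_poly big_map mulr_sumr; apply: eq_bigr => p _; rewrite mulrA.
Qed.

Lemma tree_poly_cat L q l1 l2 (x : R) :
  tree_poly L q (l1 ++ l2) x = tree_poly L q l1 x + tree_poly L q l2 x.
Proof. exact: big_cat. Qed.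

Lemma cmeasurable_tree_poly L q l : cmeasurable (tree_poly L q l).
Proof.
by apply: cmeasurable_sum => p; apply/cmeasurableZ/cmeasurable_expo.
Qed.

(** Self-similarity splits the error on the Cantor set orthogonally into the
    errors of the two subtrees. *)
Lemma sqint_join L q (n : int) f f0 f1 l0 l1 :
  L q = 2 * n + 1 -> cmeasurable f -> cmeasurable f0 -> cmeasurable f1 ->
  (forall y : R, f (tau1 y) = f0 y + expo ((L q)%:~R / 4) y * f1 y) ->
  (forall y : R, f (tau2 y) = f0 y - expo ((L q)%:~R / 4) y * f1 y) ->
  sq (fun x => f x - tree_poly L q (tree_poly_join l0 l1) x) =
  (sq (fun x => (f0 x - tree_poly L (2 * q + 1) l0 x)%R) +
   sq (fun x => (f1 x - tree_poly L (2 * q + 2) l1 x)%R))%E.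
Proof.
move=> Lq mf mf0 mf1 ft1 ft2.
have me s : cmeasurable (expo s : T -> R[i]) := cmeasurable_expo s.
have mp q' l' : cmeasurable (tree_poly L q' l') := cmeasurable_tree_poly L q' l'.
rewrite (sqint_cantor hmu4); last exact: cmeasurableB.
pose E (x : T) := expo ((L q)%:~R / 4) x * (f1 x - tree_poly L (2 * q + 2) l1 x).
have mE : cmeasurable E by apply: cmeasurableM => //; exact: cmeasurableB.
have -> : sq (fun x => f1 x - tree_poly L (2 * q + 2) l1 x) = sq E.
  by apply: eq_integral => x _; rewrite /E normsqM normsq_expo mul1r.
rewrite -(sqint_parallelogram mu4 (cmeasurableB mf0 (mp _ l0)) mE).
have e4 y : expo (L q)%:~R (4^-1 * y) = expo ((L q)%:~R / 4) y :> R[i].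
  by rewrite expo_mulr mulrC.
congr (_ * _ + _ * _)%E; apply: sqint_ext => y /=.
  rewrite ft1 tree_poly_joinE /tau1 mulVKf ?pnatr_eq0// e4 /E.
  by move: (expo _ _) => u; ring.
rewrite ft2 tree_poly_joinE /tau2 mulVKf ?pnatr_eq0// mulrDr expoDr e4 !tree_polyD2.
rewrite [4^-1 * 2](_ : _ = 2^-1); last by field.
have -> : expo (L q)%:~R 2^-1 = -1 :> R[i] by rewrite Lq expo_odd_half.
by rewrite /E; move: (expo _ _) => u; ring.
Qed.

Lemma sqint_expo s : sq (expo s) = 1%E.
Proof.
rewrite /sqint; under eq_integral do rewrite normsq_expo.
by rewrite integral_cst// mul1e; exact: probability_setT.
Qed.

(** [|expo s x - 1|^2 = 4 sin^2 (pi s x)]. *)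
Lemma normsq_expoB1_le s (x : R) : 0 <= x < 1 -> normsq (expo s x - 1) <= 64 * s ^+ 2.
Proof.
move=> /andP[x0 x1].
have e : 2 * pi * s * x = (pi / 2 * (2 * (s * x))) *+ 2 by rewrite mulr2n; field.
have h := sqr_sin_pihalf_le (2 * (s * x)).
have -> : normsq (expo s x - 1) = 4 * sin (pi / 2 * (2 * (s * x))) ^+ 2.
  rewrite /expo e cos_mulr2n sin_mulr2n /normsq /= cos2sin2.
  have := cos2Dsin2 (pi / 2 * (2 * (s * x))); move: (cos _) (sin _) => a b ab.
  transitivity (4 * b ^+ 2 * (a ^+ 2 + b ^+ 2)); last by rewrite ab mulr1.
  by rewrite !mulr2n; ring.
have : (s * x) ^+ 2 <= s ^+ 2; last by nra.
by rewrite exprMn ler_piMr ?sqr_ge0// expr_le1// ltW.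
Qed.

Lemma sqint_expoB1_le s : (sq (fun x => expo s x - 1)%R <= (64 * s ^+ 2)%:E)%E.
Proof.
have -> : ((64 * s ^+ 2)%:E = \int[mu4]_x (64 * s ^+ 2)%:E)%E.
  by rewrite integral_cst// [X in (_ * X)%E](_ : _ = 1%E) ?mule1//; exact: probability_setT.
apply: ae_ge0_le_integral => //.
- by move=> x _; rewrite lee_fin normsq_ge0.
- by apply/measurable_normsq/cmeasurableB; [exact: cmeasurable_expo|exact: cmeasurable_cst].
- by move=> x _; rewrite lee_fin mulr_ge0 ?sqr_ge0.
apply: (cantor_ae hmu4) => x x01; rewrite lee_fin; exact: normsq_expoB1_le.
Qed.

Lemma sqint_scaled L q z f l : cmeasurable f ->
  sq (fun x => z * f x - tree_poly L q [seq (z * p.1, p.2) | p <- l] x) =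
  ((normsq z)%:E * sq (fun x => (f x - tree_poly L q l x)%R))%E.
Proof.
move=> mf; rewrite -sqintZ; last first.
  by apply: cmeasurableB => //; exact: cmeasurable_tree_poly.
by apply: sqint_ext => x; rewrite tree_polyZ mulrBr.
Qed.

(** The recursion defining [tree_error] is exactly what [sqint_join] gives when the
    two halves of [expo s] are approximated in the two subtrees. *)
Lemma exists_tree_poly_expo L n q s :
  (forall p, exists k : int, L p = 2 * k + 1) ->
  exists l, (sq (fun x => (expo s x - tree_poly L q l x)%R) <= (tree_error L n q s)%:E)%E.
Proof.
move=> Lodd; elim: n q s => [|n IH] q s /=.
  rewrite /base_error; have [s1|s1] := leP 1 (64 * s ^+ 2).
    exists [::]; apply: le_trans (_ : (sq (expo s) <= _)%E); last by rewrite sqint_expo.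
    rewrite le_eqVlt; apply/orP; left; apply/eqP; apply: sqint_ext => x.
    by rewrite /tree_poly big_nil subr0.
  exists [:: (1, [::])].
  apply: le_trans (sqint_expoB1_le s).
  rewrite le_eqVlt; apply/orP; left; apply/eqP; apply: sqint_ext => x.
  by rewrite /tree_poly big_seq1 /= expo0 mulr1.
have [k Lq] := Lodd q; set a := (L q)%:~R.
have [l0 h0] := IH (2 * q + 1)%N (s / 4).
have [l1 h1] := IH (2 * q + 2)%N ((s - a) / 4).
pose al := 2^-1 * (1 + expo s 2^-1); pose be := 2^-1 * (1 - expo s 2^-1).
have ab : al + be = 1 by rewrite /al /be; move: (expo _ _) => u; field.
have abB : al - be = expo s 2^-1 by rewrite /al /be; move: (expo _ _) => u; field.
exists (tree_poly_join [seq (al * p.1, p.2) | p <- l0] [seq (be * p.1, p.2) | p <- l1]).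
have mZ z t : cmeasurable (fun x : T => z * expo t x).
  by apply: cmeasurableZ; exact: cmeasurable_expo.
have eb (y : R) : expo (a / 4) y * (be * expo ((s - a) / 4) y) = be * expo (s / 4) y.
  by rewrite mulrCA -expoD; congr (_ * expo _ _); field.
rewrite (@sqint_join L q k _ (fun x => al * expo (s / 4) x) (fun x => be * expo ((s - a) / 4) x))//.
- rewrite -normsq_half_sum -normsq_half_diff -/al -/be EFinD !EFinM.
  rewrite !sqint_scaled; try exact: cmeasurable_expo.
  by apply: leeD; apply: lee_wpmul2l => //; rewrite lee_fin normsq_ge0.
- exact: cmeasurable_expo.
- move=> y; rewrite eb -mulrDl ab mul1r /tau1 expo_mulr mulrC.
  by congr (expo _ _); field.
- move=> y; rewrite eb -mulrBl abB /tau2 mulrDr expoDr expo_mulr mulrC.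
  by congr (expo _ _ * expo _ _); field.
Qed.

End TreeApproximation.

(** * Density *)

Section Density.
Context {R : realType}.
Variable mu4 : probability (measurableTypeR R) R.
Hypothesis hmu4 : middle_fourth_Cantor mu4.

Local Notation T := (measurableTypeR R).
Local Notation sq := (sqint mu4).
Implicit Types (L : nat -> int) (f g : T -> R[i]).

Definition approximable L q f := cmeasurable f /\
  forall eps : R, 0 < eps ->
    exists l, (sq (fun x => (f x - tree_poly L q l x)%R) < eps%:E)%E.

Lemma approximableZ L q z f :
  approximable L q f -> approximable L q (fun x => z * f x).
Proof.
move=> [mf fa]; split; first exact: cmeasurableZ.
move=> eps eps0; have z0 := normsq_ge0 z.
have e0 : 0 < eps / (normsq z + 1) by rewrite divr_gt0// ltr_wpDl.
have [l hl] := fa _ e0; exists [seq (z * p.1, p.2) | p <- l].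
rewrite sqint_scaled//.
apply: (@le_lt_trans _ _ ((normsq z)%:E * (eps / (normsq z + 1))%:E)%E).
  by apply: lee_wpmul2l; [rewrite lee_fin|exact: ltW].
rewrite -EFinM lte_fin mulrCA gtr_pMr// ltr_pdivrMr ?ltr_wpDl//.
by rewrite mul1r ltrDl.
Qed.

Lemma approximable_lim L q f : cmeasurable f ->
  (forall eps : R, 0 < eps -> exists g, approximable L q g /\
    (sq (fun x => (f x - g x)%R) < eps%:E)%E) ->
  approximable L q f.
Proof.
move=> mf fg; split=> // eps eps0.
have e4 : 0 < eps / 4 by rewrite divr_gt0.
have [g [[mg ga] hg]] := fg _ e4; have [l hl] := ga _ e4; exists l.
have mp : cmeasurable (tree_poly L q l : T -> R[i]) := cmeasurable_tree_poly L q l.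
have -> : sq (fun x => f x - tree_poly L q l x) =
    sq (fun x => (f x - g x) + (g x - tree_poly L q l x)).
  by apply: sqint_ext => x; rewrite addrA subrK.
apply: le_lt_trans (sqintD_le _ _ _) _; try exact: cmeasurableB.
have -> : eps = 2 * (eps / 4) + 2 * (eps / 4) by field.
by rewrite (EFinD (2 * _)) !(EFinM 2 (_ / _)); apply: lteD; rewrite lte_pmul2l.
Qed.

Lemma approximableD L q f g :
  approximable L q f -> approximable L q g -> approximable L q (fun x => f x + g x).
Proof.
move=> [mf fa] [mg ga]; split; first exact: cmeasurableD.
move=> eps eps0; have e4 : 0 < eps / 4 by rewrite divr_gt0.
have [l1 h1] := fa _ e4; have [l2 h2] := ga _ e4; exists (l1 ++ l2).
have mp l : cmeasurable (tree_poly L q l : T -> R[i]) := cmeasurable_tree_poly L q l.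
have -> : sq (fun x => f x + g x - tree_poly L q (l1 ++ l2) x) =
    sq (fun x => (f x - tree_poly L q l1 x) + (g x - tree_poly L q l2 x)).
  by apply: sqint_ext => x; rewrite tree_poly_cat; ring.
apply: le_lt_trans (sqintD_le _ _ _) _; try exact: cmeasurableB.
have -> : eps = 2 * (eps / 4) + 2 * (eps / 4) by field.
by rewrite (EFinD (2 * _)) !(EFinM 2 (_ / _)); apply: lteD; rewrite lte_pmul2l.
Qed.

Lemma approximableB L q f g :
  approximable L q f -> approximable L q g -> approximable L q (fun x => f x - g x).
Proof.
move=> fa ga; under eq_fun do rewrite -mulN1r.
by apply: approximableD => //; exact: approximableZ.
Qed.

Lemma approximable0 L q : approximable L q (fun=> 0).
Proof.
split=> [|eps eps0]; first exact: cmeasurable_cst.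
exists [::]; rewrite (_ : sq _ = 0%E) ?lte_fin//.
by rewrite -(sqint0 mu4); apply: sqint_ext => x; rewrite /tree_poly big_nil subr0.
Qed.

Lemma approximable_sum L q (I : eqType) (s : seq I) (F : I -> T -> R[i]) :
  (forall i, i \in s -> approximable L q (F i)) ->
  approximable L q (fun x => \sum_(i <- s) F i x).
Proof.
elim: s => [|i s IH] Fa.
  by under eq_fun do rewrite big_nil; exact: approximable0.
under eq_fun do rewrite big_cons; apply: approximableD.
  by apply: Fa; rewrite mem_head.
by apply: IH => j js; apply: Fa; rewrite inE js orbT.
Qed.

(** The measure is carried by [0, 1[, so changing values elsewhere changes no
    distance. *)
Lemma approximable_unit L q f g : cmeasurable g ->
  (forall x : R, 0 <= x < 1 -> g x = f x) ->
  approximable L q f -> approximable L q g.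
Proof.
move=> mg fg fa; apply: approximable_lim => // eps eps0; exists f; split=> //.
apply: (@le_lt_trans _ _ 0%E); last by rewrite lte_fin.
have -> : (0 = \int[mu4]_x 0 :> \bar R)%E by rewrite integral0.
apply: ae_ge0_le_integral => //.
- by move=> x _; rewrite lee_fin normsq_ge0.
- by apply/measurable_normsq/cmeasurableB => //; exact: fa.1.
- apply: (cantor_ae hmu4) => x /fg ->.
  by rewrite subrr /normsq /= expr0n addr0.
Qed.

Section GoodLabels.
Variable L : nat -> int.
Hypothesis Lodd : forall p, exists k : int, L p = 2 * k + 1.
Hypothesis Lsmall : forall q (s : rat) (eps : R), 0 < eps ->
  exists n, tree_error L n q (ratr s) < eps.

Lemma approximable_join q f f0 f1 :
  cmeasurable f ->
  (forall y : R, f (tau1 y) = f0 y + expo ((L q)%:~R / 4) y * f1 y) ->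
  (forall y : R, f (tau2 y) = f0 y - expo ((L q)%:~R / 4) y * f1 y) ->
  approximable L (2 * q + 1) f0 -> approximable L (2 * q + 2) f1 ->
  approximable L q f.
Proof.
move=> mf ft1 ft2 [mf0 fa0] [mf1 fa1]; split=> // eps eps0.
have e2 : 0 < eps / 2 by rewrite divr_gt0.
have [l0 h0] := fa0 _ e2; have [l1 h1] := fa1 _ e2; have [k Lq] := Lodd q.
exists (tree_poly_join l0 l1).
rewrite (sqint_join hmu4 l0 l1 Lq mf mf0 mf1)//.
by rewrite (splitr eps) EFinD lteD.
Qed.

Lemma approximable_expo q (s : rat) : approximable L q (expo (ratr s)).
Proof.
split=> [|eps eps0]; first exact: cmeasurable_expo.
have [n hn] := Lsmall q s eps0.
have [l hl] := exists_tree_poly_expo hmu4 n q (ratr s) Lodd.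
by exists l; apply: le_lt_trans hl _; rewrite lte_fin.
Qed.

Definition ind (A : set T) (x : T) : R[i] := (\1_A x)%:C%C.

Lemma cmeasurable_ind (A : set T) : measurable A -> cmeasurable (ind A).
Proof. by move=> mA; apply: cmeasurable_real; exact: measurable_indic. Qed.

Definition ray (n : nat) (j : int) : set T := [set x | j%:~R / 4 ^+ n <= x].

Lemma measurable_ray n j : measurable (ray n j).
Proof.
have -> : ray n j = `[j%:~R / 4 ^+ n, +oo[%classic.
  by apply/seteqP; split => x /=; rewrite in_itv/= andbT.
exact: measurable_itv.
Qed.

Lemma ind_mem (A : set T) x : A x -> ind A x = 1.
Proof. by move=> Ax; rewrite /ind indicE mem_set. Qed.

Lemma ind_nmem (A : set T) x : ~ A x -> ind A x = 0.
Proof. by move=> Ax; rewrite /ind indicE memNset. Qed.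

Lemma ind_iff (A B : set T) x y : (A x <-> B y) -> ind A x = ind B y.
Proof.
have [Ax|Ax] := pselect (A x) => AB; first by rewrite !ind_mem//; exact/AB.
by rewrite !ind_nmem// => By; apply/Ax/AB.
Qed.

(** Induction on [n]: the two maps pull the ray with endpoint [j / 4^(n+1)] back to
    rays with endpoint in [4^-n Z], and multiplication by exponentials with
    rational frequency preserves the statement; for [n = 0] the ray contains
    [0, 1[ or is disjoint from it. *)
Lemma approximable_expo_ray n q j (s : rat) :
  approximable L q (fun x => expo (ratr s) x * ind (ray n j) x).
Proof.
have mer n' j' t : cmeasurable (fun x : T => expo t x * ind (ray n' j') x).
  apply: cmeasurableM; first exact: cmeasurable_expo.
  by apply: cmeasurable_ind; exact: measurable_ray.
elim: n q j s => [|n IH] q j s.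
  have [j0|j0] := leP j 0.
    apply: (approximable_unit (mer _ _ _) _ (approximable_expo q s)) => x /andP[x0 x1].
    rewrite ind_mem ?mulr1// /ray /= expr0 divr1.
    by apply: le_trans x0; rewrite -[leRHS]/(0%:~R) ler_int.
  apply: (approximable_unit (mer _ _ _) _ (approximable0 _ _)) => x /andP[x0 x1].
  rewrite ind_nmem ?mulr0// /ray /= expr0 divr1; apply/negP; rewrite -ltNge.
  apply: lt_le_trans x1 _; rewrite -[leLHS]/(1%:~R) ler_int; lia.
have n0 : 0 < 4 ^+ n :> R by rewrite exprn_gt0.
pose j' := j - 2 * 4 ^+ n.
pose z : R[i] := expo (ratr s) 2^-1.
have r1 (y : R) : ind (ray n.+1 j) (tau1 y) = ind (ray n j) y.
  apply: ind_iff; rewrite /ray /tau1 /= exprS invfM mulrCA; move: (_ / 4 ^+ n) => u.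
  by split; lra.
have r2 (y : R) : ind (ray n.+1 j) (tau2 y) = ind (ray n j') y.
  have e : j'%:~R / 4 ^+ n = j%:~R / 4 ^+ n - 2 :> R.
    by rewrite /j' intrB intrM mulrBl rmorphXn /= mulfK ?gt_eqF.
  apply: ind_iff; rewrite /ray /tau2 /= e exprS invfM mulrCA; move: (j%:~R / 4 ^+ n) => u.
  by split; lra.
have es (y : R) : expo (ratr s) (tau1 y) = expo (ratr (s / 4)) y.
  by rewrite /tau1 expo_mulr; congr expo; rewrite rmorphM fmorphV rmorph_nat mulrC.
have es2 (y : R) : expo (ratr s) (tau2 y) = expo (ratr (s / 4)) y * z.
  by rewrite -es /tau1 /tau2 mulrDr expoDr; congr (_ * expo _ _); field.
have ea (y : R) : expo ((L q)%:~R / 4) y * expo (ratr ((s - (L q)%:~R) / 4)) y = expo (ratr (s / 4)) y.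
  rewrite -expoD; congr expo; rewrite !rmorphM rmorphB /= fmorphV rmorph_nat ratr_int.
  by field.
pose e0 (y : T) : R[i] := expo (ratr (s / 4)) y.
pose e1 (y : T) : R[i] := expo (ratr ((s - (L q)%:~R) / 4)) y.
apply: (@approximable_join q _
  (fun y => 2^-1 * (e0 y * ind (ray n j) y) + 2^-1 * z * (e0 y * ind (ray n j') y))
  (fun y => 2^-1 * (e1 y * ind (ray n j) y) - 2^-1 * z * (e1 y * ind (ray n j') y))).
- exact: mer.
- by move=> y; rewrite r1 es /e0 /e1 -ea; field.
- by move=> y; rewrite r2 es2 /e0 /e1 -ea; field.
- by apply: approximableD; apply: approximableZ; exact: IH.
- by apply: approximableB; apply: approximableZ; exact: IH.
Qed.

End GoodLabels.
End Density.

Section SquareIntegrableDensity.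
Context {R : realType}.
Variable mu4 : probability (measurableTypeR R) R.
Hypothesis hmu4 : middle_fourth_Cantor mu4.

Local Notation T := (measurableTypeR R).
Local Notation sq := (sqint mu4).

Variable L : nat -> int.
Hypothesis Lodd : forall p, exists k : int, L p = 2 * k + 1.
Hypothesis Lsmall : forall q (s : rat) (eps : R), 0 < eps ->
  exists n, tree_error L n q (ratr s) < eps.

Local Notation approx := (approximable mu4 L 0).

Definition rays : set (set T) := [set A | exists n j, A = ray n j].

Lemma rays_setI_closed : setI_closed rays.
Proof.
move=> _ _ [n1 [j1 ->]] [n2 [j2 ->]].
have [h|h] := leP (j1%:~R / 4 ^+ n1 : R) (j2%:~R / 4 ^+ n2).
  exists n2, j2; apply/seteqP; split => x; rewrite /ray /=; first by case.
  by move=> xj; split=> //; exact: le_trans xj.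
exists n1, j1; apply/seteqP; split => x; rewrite /ray /=; first by case.
by move=> xj; split=> //; apply: le_trans xj; exact: ltW.
Qed.

(** Every half-line is the intersection of the rays that contain it. *)
Lemma measurable_rays : @measurable _ T = <<s rays >>.
Proof.
apply/seteqP; split; last first.
  apply: smallest_sub; first exact: sigma_algebra_measurable.
  by move=> _ [n [j ->]]; exact: measurable_ray.
rewrite [X in X `<=` _]RGenCInfty.measurableE.
apply: smallest_sub; first exact: smallest_sigma_algebra.
move=> _ [x ->].
pose F n := ray n (Num.floor (x * 4 ^+ n)) : set T.
have -> : `[x, +oo[%classic = \bigcap_n F n.
  apply/seteqP; split => y /=.
    rewrite in_itv/= andbT => xy n _; rewrite /F /ray /=.
    rewrite ler_pdivrMr ?exprn_gt0//; apply: le_trans (floor_le _) _.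
    by rewrite ler_pM2r ?exprn_gt0.
  move=> yF; rewrite in_itv/= andbT leNgt; apply/negP => yx.
  pose n := (Num.truncn (x - y)^-1).+1.
  have n4 : (x - y)^-1 < 4 ^+ n.
    apply: lt_le_trans (truncnS_gt _) _.
    by rewrite -natrX ler_nat ltnW// ltn_expl.
  have := yF n I; rewrite /F /ray /= ler_pdivrMr ?exprn_gt0// => h.
  have := floorD1_gt (x * 4 ^+ n); rewrite intrD => h2.
  have xy0 : 0 < x - y by rewrite subr_gt0.
  have : 1 < (x - y) * 4 ^+ n by rewrite mulrC -ltr_pdivrMr// mul1r.
  by lra.
apply: (@bigcap_measurable _ (g_sigma_algebraType rays)) => // n _.
by apply: sub_sigma_algebra; exists n, (Num.floor (x * 4 ^+ n)).
Qed.

Lemma approximable_dominated (F : nat -> T -> R[i]) (f : T -> R[i]) (g : T -> R) :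
  cmeasurable f -> (forall n, approx (F n)) ->
  (forall x, normsq (f x - F n x) @[n --> \oo] --> (0 : R)) ->
  mu4.-integrable setT (EFin \o g) ->
  (forall n x, normsq (f x - F n x) <= g x) -> approx f.
Proof.
move=> mf Fa Ff ig Fg; apply: approximable_lim => // eps eps0.
have mD n : measurable_fun setT (fun x : T => (normsq (f x - F n x))%:E).
  by apply/measurable_normsq/cmeasurableB => //; exact: (Fa n).1.
have [|||_ _] := @dominated_convergence _ _ _ mu4 setT measurableT
    (fun n x => (normsq (f x - F n x))%:E) (fun=> 0%E) (EFin \o g) mD _ _ ig _.
- exact: measurable_cst.
- by apply: nearW => x _; apply/fine_cvgP; split; [exact: nearW|exact: Ff].
- apply: nearW => x n _; rewrite /= lee_fin ger0_norm ?normsq_ge0//; exact: Fg.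
rewrite integral0 => /= h.
have /h : ereal_nbhs (0 : \bar R)%E (fun u => (u < eps%:E)%E).
  by apply: open_ereal_lt'; rewrite lte_fin.
move=> [n _ /(_ n (leqnn n)) /= hn].
by exists (F n).
Qed.

Lemma normsq_indB (A B : set T) x : normsq (ind A x - ind B x) <= 1.
Proof.
have n0 : normsq (0 : R[i]) = 0 by rewrite /normsq /= expr0n addr0.
have n1 : normsq (1 : R[i]) = 1 by rewrite /normsq /= expr1n expr0n addr0.
have nN1 : normsq (-1 : R[i]) = 1 by rewrite /normsq /= sqrrN expr1n oppr0 expr0n addr0.
have [Ax|Ax] := pselect (A x); have [Bx|Bx] := pselect (B x).
- by rewrite !ind_mem// subrr n0.
- by rewrite ind_mem// ind_nmem// subr0 n1.
- by rewrite ind_nmem// ind_mem// sub0r nN1.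
- by rewrite !ind_nmem// subrr n0.
Qed.

(** Dynkin's theorem: the rays are stable under intersection and generate the
    Borel sets. *)
Lemma approximable_ind (A : set T) : measurable A -> approx (ind A).
Proof.
move=> mA; have := mA; rewrite {1}measurable_rays.
move: A {mA}; apply: (@dynkin_induction _ T rays (fun A => approx (ind A))).
- exact: measurable_rays.
- exact: rays_setI_closed.
- have := approximable_expo hmu4 Lodd Lsmall 0 0; rewrite rmorph0.
  by congr approximable; apply/funext => x; rewrite expo0 ind_mem.
- move=> _ [n [j ->]].
  have := approximable_expo_ray hmu4 Lodd Lsmall n 0 j 0; rewrite rmorph0.
  by congr approximable; apply/funext => x; rewrite expo0 mul1r.
- move=> S mS aS; have aT : approx (ind setT).
    have := approximable_expo hmu4 Lodd Lsmall 0 0; rewrite rmorph0.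
    by congr approximable; apply/funext => x; rewrite expo0 ind_mem.
  have := approximableB aT aS; congr approximable; apply/funext => x.
  have [Sx|Sx] := pselect (S x); last by rewrite (ind_nmem Sx) subr0 !ind_mem.
  by rewrite (ind_mem Sx) ind_mem// subrr ind_nmem//= => /(_ Sx).
- move=> F mF tF Fa.
  pose P n := \bigcup_(k in `I_n) F k.
  have Pa n : approx (ind (P n)).
    elim: n => [|n IH].
      have := approximable0 mu4 L 0; congr approximable; apply/funext => x.
      by rewrite ind_nmem// => -[].
    have := approximableD IH (Fa n); congr approximable; apply/funext => x.
    have [Px|Px] := pselect (P n x).
      rewrite (ind_mem Px) ind_nmem ?ind_mem ?addr0//.
        by case: Px => k /= kn Fk; exists k => //=; exact: ltnW.
      move=> Fn; case: Px => k /= kn Fk.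
      have /trivIsetP/(_ k n I I) := tF; rewrite (ltn_eqF kn) => /(_ isT) Fkn.
      by have : (F k `&` F n) x by []; rewrite Fkn.
    rewrite (ind_nmem Px) add0r; apply: ind_iff; split=> [Fn|]; first by exists n => /=.
    move=> [k /=]; rewrite ltnS leq_eqVlt => /predU1P[->//|kn Fk].
    by exfalso; apply: Px; exists k.
  have mU : measurable (\bigcup_k F k) by exact: bigcupT_measurable.
  apply: (@approximable_dominated (fun n => ind (P n)) _ (fun=> 1)).
  + exact: cmeasurable_ind.
  + by [].
  + move=> x; have n0 : normsq (0 : R[i]) = 0 by rewrite /normsq /= expr0n addr0.
    have [[k _ Fk]|Ux] := pselect ((\bigcup_k F k) x).
      apply: (@cvg_near_cst _ _ _ _ _ _); exists k.+1 => // n /= kn.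
      have Ux : (\bigcup_k F k) x by exists k.
      have Px : P n x by exists k.
      by rewrite (ind_mem Ux) (ind_mem Px) subrr n0.
    apply: (@cvg_near_cst _ _ _ _ _ _); apply: nearW => n.
    have Px : ~ P n x by move=> [k _ Fk]; apply: Ux; exists k.
    by rewrite (ind_nmem Ux) (ind_nmem Px) subrr n0.
  + exact: (@bounded_integrable _ _ _ mu4 (fun=> 1) `|1|).
  + by move=> n x; exact: normsq_indB.
Qed.

Import HBNNSimple.

Lemma approximable_real (h : T -> R) : measurable_fun setT h ->
  (forall x, 0 <= h x) -> mu4.-integrable setT (EFin \o (fun x => h x ^+ 2)) ->
  approx (fun x => (h x)%:C%C).
Proof.
move=> mh h0 ih.
have mh' : measurable_fun setT (EFin \o h) by exact/measurable_EFinP.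
have [g [gnd gcvg]] := approximation measurableT mh' (fun x _ => h0 x : (0 <= (h x)%:E)%E).
have gx x : g n x @[n --> \oo] --> h x.
  by have /fine_cvgP[_] := gcvg x I.
have gle n x : 0 <= g n x <= h x.
  rewrite fun_ge0/= -(cvg_lim (@Rhausdorff R) (gx x)).
  apply: (@nondecreasing_cvgn_le _ (fun n => g n x)); last first.
    by apply/cvg_ex; exists (h x); exact: gx.
  by move=> a b ab; have /lefP := gnd _ _ ab; exact.
have nsq (a b : R) : normsq (a%:C%C - b%:C%C) = (a - b) ^+ 2.
  by rewrite -rmorphB /normsq /= expr0n addr0.
apply: (@approximable_dominated (fun n x => (g n x)%:C%C) _ (fun x => h x ^+ 2)) => //.
- move=> n.
  have -> : (fun x : T => (g n x)%:C%C) = (fun x : T =>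
      \sum_(y <- fset_set (range (g n))) y%:C%C * ind (g n @^-1` [set y]) x).
    apply/funext => x; rewrite fimfunE fsbig_finite//= rmorph_sum.
    by apply: eq_bigr => y _; rewrite rmorphM.
  apply: approximable_sum => y _; apply: approximableZ; exact: approximable_ind.
- move=> x; under eq_fun do rewrite nsq.
  have -> : 0 = (h x - h x) ^+ 2 :> R by rewrite subrr expr0n.
  have hg : h x - g n x @[n --> \oo] --> h x - h x.
    by apply: cvgB; [exact: cvg_cst|exact: gx].
  by rewrite expr2; under eq_fun do rewrite expr2; exact: cvgM.
- by move=> n x; rewrite nsq; have := gle n x; have := h0 x; nra.
Qed.

Lemma approximable_complexL2 (f : T -> R[i]) : complexL2 mu4 f -> approx f.
Proof.
move=> /complexL2_sqint[[mf1 mf2] fint].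
have real_part (h : T -> R) : measurable_fun setT h ->
    (forall x, h x ^+ 2 <= normsq (f x)) -> approx (fun x => (h x)%:C%C).
  move=> mh hf.
  have pos (k : T -> R) : measurable_fun setT k -> (forall x, 0 <= k x) ->
      (forall x, k x <= `|h x|) -> approx (fun x => (k x)%:C%C).
    move=> mk k0 kh; apply: approximable_real => //.
    apply/integrableP; split; first by apply/measurable_EFinP; exact: measurable_funX.
    apply: le_lt_trans fint; apply: ge0_le_integral => //=.
    - by apply/measurable_EFinP/measurableT_comp => //; exact: measurable_funX.
    - exact: measurable_normsq.
    - move=> x _; rewrite lee_fin ger0_norm ?sqr_ge0//; apply: le_trans (hf x).
      by rewrite -(real_normK (num_real (h x))) ler_sqr ?nnegrE.
  have hpos : approx (fun x => (Num.max (h x) 0)%:C%C).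
    apply: pos; first by apply: measurable_maxr => //; exact: measurable_cst.
      by move=> x; rewrite le_max lexx orbT.
    by move=> x; rewrite ge_max ler_norm normr_ge0.
  have hneg : approx (fun x => (Num.max (- h x) 0)%:C%C).
    apply: pos; first by apply: measurable_maxr; [exact: measurableT_comp|exact: measurable_cst].
      by move=> x; rewrite le_max lexx orbT.
    by move=> x; rewrite ge_max -normrN ler_norm normr_ge0.
  have := approximableB hpos hneg; congr approximable; apply/funext => x.
  rewrite -rmorphB; congr (_%:C%C).
  by case: (leP (h x) 0) => ?; case: (leP (- h x) 0) => ?; lra.
have fR : approx (fun x => (complex.Re (f x))%:C%C).
  by apply: real_part => // x; rewrite lerDl sqr_ge0.
have fI : approx (fun x => (complex.Im (f x))%:C%C).
  by apply: real_part => // x; rewrite lerDr sqr_ge0.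
have := approximableD fR (approximableZ (Complex 0 1) fI); congr approximable.
by apply/funext => x; exact: (esym (complexE (f x))).
Qed.

End SquareIntegrableDensity.

(** * Orthogonality and the combinatorics of the tree *)

Section TreeFrequencies.
Implicit Types (L : nat -> int) (b : seq bool).

Lemma tree_value_head L q b : tree_value L q b =
  if head false b then L q + 4 * tree_value L (2 * q + 2) (behead b)
  else 4 * tree_value L (2 * q + 1) (behead b).
Proof. by case: b => [|[] b] //=; rewrite mulr0. Qed.

Lemma tree_value_rcons_false L q b :
  tree_value L q (rcons b false) = tree_value L q b.
Proof. by elim: b q => [|[] b IH] q /=; rewrite ?mulr0 ?IH. Qed.

(** Two branches agree up to some level, where exactly one of them takes its
    odd label; the later levels contribute multiples of higher powers of 4. *)
Lemma tree_value_diff L q b b' :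
  (forall p, exists k : int, L p = 2 * k + 1) ->
  tree_value L q b = tree_value L q b' \/
  exists j (n : int), tree_value L q b - tree_value L q b' = 4 ^+ j * (2 * n + 1).
Proof.
move=> Lodd; have [N] : exists N, (size b <= N)%N /\ (size b' <= N)%N.
  by exists (maxn (size b) (size b')); rewrite leq_maxl leq_maxr.
elim: N q b b' => [|N IH] q b b'.
  by rewrite !leqn0 !size_eq0 => -[/eqP-> /eqP->]; left.
move=> [bN bN'].
have sz (c : seq bool) : (size c <= N.+1)%N -> (size (behead c) <= N)%N.
  by rewrite size_behead; lia.
have {}bN := sz _ bN; have {}bN' := sz _ bN'; have [k Lk] := Lodd q.
rewrite !(tree_value_head L q); case: (head false b); case: (head false b').
- have [->|[j [n e]]] := IH (2 * q + 2)%N _ _ (conj bN bN'); first by left.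
  right; exists j.+1, n; rewrite exprS -mulrA -e; ring.
- right; exists 0, (k + 2 * (tree_value L (2 * q + 2) (behead b)
    - tree_value L (2 * q + 1) (behead b'))).
  by rewrite expr0 Lk; ring.
- right; exists 0, (- k - 1 + 2 * (tree_value L (2 * q + 1) (behead b)
    - tree_value L (2 * q + 2) (behead b'))).
  by rewrite expr0 Lk; ring.
- have [->|[j [n e]]] := IH (2 * q + 1)%N _ _ (conj bN bN'); first by left.
  by right; exists j.+1, n; rewrite exprS -mulrA -e; ring.
Qed.

Definition path_bits (k : nat -> nat) i n := [seq odd (k (i + j).+1) | j <- iota 0 n].

(** The vertex at level [i] on the path [k] has breadth-first number
    [2^i + k_i - 1], where [k_i = k_(i+1) / 2]; the second form also gives the root
    for [i = 0], as [is_path] constrains [k] from 1 on. *)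
Lemma path_sum L k i n : (forall j, (k j.+2)./2 = k j.+1) ->
  \sum_(0 <= j < n) 4 ^+ j * tree_label L (i + j).+1 (k (i + j).+1) =
  tree_value L (2 ^ i + (k i.+1)./2).-1 (path_bits k i n).
Proof.
move=> kk; elim: n i => [|n IH] i; first by rewrite big_geq.
rewrite big_nat_recl// expr0 mul1r addn0 /path_bits /= -/(iota 1 n).
have -> : [seq odd (k (i + j).+1) | j <- iota 1 n] = path_bits k i.+1 n.
  rewrite /path_bits (iotaDl 1 0 n) -map_comp; apply: eq_map => j /=.
  by rewrite addnS addSn.
have -> : \sum_(0 <= j < n) 4 ^+ j.+1 * tree_label L (i + j.+1).+1 (k (i + j.+1).+1) =
    4 * tree_value L (2 ^ i.+1 + k i.+1).-1 (path_bits k i.+1 n).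
  rewrite -kk -IH mulr_sumr; apply: eq_bigr => j _.
  by rewrite exprS -mulrA addnS addSn.
have i0 : (0 < 2 ^ i)%N by rewrite expn_gt0.
have := odd_double_half (k i.+1); rewrite addn0 /tree_label /= => ki.
case: (odd (k i.+1)) ki => /= ki.
  congr (L _ + 4 * tree_value L _ _); last by (rewrite expnS; lia).
  by rewrite -ki /= doubleK uphalf_double.
by rewrite add0r; congr (4 * tree_value L _ _); rewrite expnS; lia.
Qed.

Lemma Lambda_tree_value (R : realType) L :
  Lambda L = [set x : R | exists b, x = (tree_value L 0 b)%:~R].
Proof.
have sumE k n : \sum_(1 <= i < n.+1) 4 ^+ i.-1 * tree_label L i (k i) =
    \sum_(0 <= j < n) 4 ^+ j * tree_label L j.+1 (k j.+1).
  by rewrite big_add1.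
apply/seteqP; split => x /=.
  move=> [k [n [[k1 kS] n1 ->]]]; exists (path_bits k 0 n).
  rewrite sumE (@path_sum L k 0 n); last first.
    by move=> j; have [->|->] := kS j.+1 isT; rewrite ?addn1 ?mul2n /= ?uphalf_double ?doubleK.
  by case: k1 => ->.
move=> [b ->].
(* The path whose successive parities are the bits of b, continued by 0. *)
pose k := fix k i := if i is i'.+1 then (2 * k i' + nth false b i')%N else 0%N.
have ok j : odd (k j.+1) = nth false b j.
  by rewrite /= oddD mul2n odd_double; case: nth.
exists k, (size b).+1; split=> //.
  split=> [|n n1]; first by rewrite /= muln0 add0n; case: nth; [right|left].
  by rewrite /=; case: nth; [right|left]; rewrite ?addn0.
rewrite sumE (@path_sum L k 0 (size b).+1); last first.
  by move=> j; rewrite [LHS]/=; case: (nth _ b j.+1); rewrite ?addn1 ?addn0 mul2n /= ?uphalf_double ?doubleK.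
congr (_%:~R).
have -> : path_bits k 0 (size b).+1 = rcons b false.
  apply: (@eq_from_nth _ false); rewrite size_map size_iota ?size_rcons// => j jb.
  rewrite (nth_map 0%N) ?size_iota// nth_iota// !add0n ok nth_rcons.
  by have [//|jb'] := ltnP j (size b); rewrite nth_default//; case: ifP.
have -> : (2 ^ 0 + (k 1)./2).-1 = 0%N by rewrite /=; case: (nth _ b 0).
by rewrite tree_value_rcons_false.
Qed.

End TreeFrequencies.

Section Orthogonality.
Context {R : realType}.
Variable mu4 : probability (measurableTypeR R) R.
Hypothesis hmu4 : middle_fourth_Cantor mu4.

Local Notation T := (measurableTypeR R).

(** For an odd frequency the contributions of the two halves of the Cantor set
    cancel; a factor 4 in an integer frequency is removed by self-similarity. *)
Lemma cantor_fourier_zero (F : R -> R) (j : nat) (n : int) :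
  measurable_fun setT (F : T -> T) -> (forall x, `|F x| <= 1) ->
  (forall x (k : int), F (x + 2 * pi * k%:~R) = F x) ->
  (forall x (k : int), F (x + pi * (2 * k + 1)%:~R) = - F x) ->
  \int[mu4]_x F (2 * pi * (4 ^+ j * (2 * n + 1))%:~R * x) = 0.
Proof.
move=> mF F1 Fper Falt.
have mFa (a : R) : measurable_fun setT (fun x : T => F (a * x)).
  by apply: (measurableT_comp mF); exact: measurable_funM.
have rep (t x : R) : 2 * pi * t * tau1 x = 2 * pi * (t / 4) * x.
  by rewrite /tau1; field.
have rep2 (t x : R) : 2 * pi * t * tau2 x = 2 * pi * (t / 4) * x + pi * t.
  by rewrite /tau2; field.
elim: j => [|j IH]; rewrite (Rintegral_cantor hmu4 (mFa _) (fun x => F1 _)).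
  under eq_Rintegral do rewrite rep.
  under [X in _ + _ * X]eq_Rintegral => x _ do rewrite rep2 expr0 mul1r Falt -mulN1r.
  rewrite RintegralZl//; first by rewrite expr0 mul1r; ring.
  exact: (@bounded_integrable _ _ _ mu4 _ 1).
have e : (4 ^+ j.+1 * (2 * n + 1))%:~R / 4 = (4 ^+ j * (2 * n + 1))%:~R :> R.
  by rewrite exprS -mulrA intrM mulrAC mulfV ?mul1r// pnatr_eq0.
under eq_Rintegral do rewrite rep e.
rewrite IH.
under eq_Rintegral => x _.
  rewrite rep2 e [pi * _](_ : _ = 2 * pi * (2 * (4 ^+ j * (2 * n + 1)))%:~R) ?Fper; last first.
    by rewrite exprS -mulrA intrM [in RHS]intrM; ring.
  over.
by rewrite IH !mulr0 addr0.
Qed.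

Lemma expoB_conj (s t x : R) : expo s x * conjc (expo t x) = expo (s - t) x.
Proof.
have -> : conjc (expo t x) = expo (- t) x.
  by rewrite /expo /= mulrN mulNr cosN sinN.
by rewrite -expoD.
Qed.

Lemma cinner_expo_refl (s : R) : cinner mu4 (expo s) (expo s) = 1.
Proof.
have P1 : fine (mu4 setT) = 1 by exact: (congr1 fine (probability_setT mu4)).
rewrite /cinner; congr Complex.
  under eq_Rintegral do rewrite expoB_conj subrr expo0 /=.
  by rewrite (Rintegral_cst mu4 measurableT) P1 mul1r.
under eq_Rintegral do rewrite expoB_conj subrr expo0 /=.
by rewrite (Rintegral_cst mu4 measurableT) mul0r.
Qed.

Lemma cinner_expo_orthogonal (s t : R) (j : nat) (n : int) :
  s - t = (4 ^+ j * (2 * n + 1))%:~R -> cinner mu4 (expo s) (expo t) = 0.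
Proof.
move=> st; rewrite /cinner; congr Complex;
  under eq_Rintegral do rewrite expoB_conj st /=; apply: cantor_fourier_zero.
- by apply: continuous_measurable_fun; exact: continuous_cos.
- exact: cos_max.
- by move=> x k; exact: cosD2piz.
- by move=> x k; exact: cosDpi_odd.
- by apply: continuous_measurable_fun; exact: continuous_sin.
- exact: sin_max.
- by move=> x k; exact: sinD2piz.
- by move=> x k; exact: sinDpi_odd.
Qed.

End Orthogonality.

(** * Spectra from labelled trees *)

Section Spectrum.
Context {R : realType}.
Variable mu4 : probability (measurableTypeR R) R.
Hypothesis hmu4 : middle_fourth_Cantor mu4.

Local Notation T := (measurableTypeR R).

Lemma int_discrete (A : set R) :
  (forall x, A x -> exists n : int, x = n%:~R) -> is_discrete A.
Proof.
move=> AZ x Ax; split; first exact: mem_set.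
exists (ball x 1); first exact: nbhsx_ballx.
apply/seteqP; split => [y [xy Ay]|_ ->]; last by split => //; exact: ballxx.
have [n xn] := AZ _ Ax; have [k yk] := AZ _ Ay.
move: xy; rewrite /ball /= xn yk -intrB -intr_norm -[1]/(1%:~R) ltr_int => h.
by congr (_%:~R); lia.
Qed.

Lemma complexL2_expo s : complexL2 mu4 (expo s).
Proof.
have [m1 m2] := cmeasurable_expo (R := R) s.
split=> //; apply: lt_trans (ltry 2); apply: cnorm2_lt => //.
rewrite sqint_expo lte_fin; lra.
Qed.

(** Branches that differ by trailing zeros carry the same frequency, so the
    coefficients are grouped by frequency. *)
Lemma tree_poly_frequencies L q (l : seq (R[i] * seq bool)) :
  exists (s : seq R) (a : R -> R[i]),
    (forall r, r \in s -> exists b, r = (tree_value L q b)%:~R) /\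
    forall x : R, tree_poly L q l x = \sum_(r <- s) a r * expo r x.
Proof.
pose v (p : R[i] * seq bool) : R := (tree_value L q p.2)%:~R.
exists (undup (map v l)), (fun r => \sum_(p <- l | v p == r) p.1); split.
  by move=> r; rewrite mem_undup => /mapP[p _ ->]; exists p.2.
move=> x; under eq_bigr do rewrite mulr_suml.
rewrite (exchange_big_dep xpredT)//= /tree_poly.
rewrite !big_seq; apply: eq_bigr => p pl.
rewrite (big_rem (v p)) /=; last by rewrite mem_undup map_f.
rewrite eqxx big_seq_cond big1 ?addr0// => r /andP[+ /eqP vr].
by rewrite mem_rem_uniq ?undup_uniq// inE -vr eqxx.
Qed.

Theorem spectrum_of_small_tree_error (L : nat -> int) :
  (forall p, exists k : int, L p = 2 * k + 1) ->
  (forall q (s : rat) (eps : R), 0 < eps ->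
     exists n, tree_error L n q (ratr s) < eps) ->
  spectrum mu4 (Lambda L).
Proof.
move=> Lodd Lsmall; rewrite Lambda_tree_value; split.
  by apply: int_discrete => x [b ->]; exists (tree_value L 0 b).
split.
- by move=> i _; exact: complexL2_expo.
- move=> _ _ [b ->] [b' ->]; have [->|e] := eqVneq; first exact: cinner_expo_refl.
  have [|[j [n h]]] := tree_value_diff 0 b b' Lodd.
    by move=> h; rewrite h eqxx in e.
  by apply: (cinner_expo_orthogonal hmu4 (j := j) (n := n)); rewrite -intrB h.
- move=> f /(approximable_complexL2 hmu4 Lodd Lsmall)[mf fa] eps eps0.
  have [l hl] := fa _ (exprn_gt0 2 eps0).
  have [s [a [sb la]]] := tree_poly_frequencies L 0 l.
  exists s, a; split=> //; apply: cnorm2_lt => //.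
  by under eq_fun do rewrite -la.
Qed.

End Spectrum.

Theorem theorem3p3 (R : realType)
  (mu4 : probability (measurableTypeR R) R) (hmu4 : middle_fourth_Cantor mu4)
  (m : nat) (hm : (2 <= m)%N)
  (C : {fset int}) (c : 'I_m -> C) (hc : bijective c)
  (hodd : forall x : int, x \in C -> ~~ (2 %| x)%Z)
  (hC : [fset (x %% 4)%Z | x in C]%fset = [fset 1%Z; 3%Z]%fset)
  (mut : probability (borel_words (letter0 hm)) R)
  (hmut : forall w : seq 'I_m,
     mut (cylinder w) = ((m%:R ^+ size w)^-1)%:E) :
  {ae pushforward mut (word_map (letter0 hm) c),
    forall L : nat -> C, spectrum mu4 (Lambda (fun p => val (L p)))}.
Proof.
have c_odd x : x \in C -> exists k : int, x = 2 * k + 1.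
  by move=> /hodd x2; exists (x %/ 2)%Z; lia.
have c_res (n : int) : exists i (l : int), 2 * n + 1 - val (c i) = 4 * l + 2.
  have : ((2 * n - 1) %% 4)%Z \in [fset (x %% 4)%Z | x in C]%fset.
    by rewrite hC !inE; lia.
  move=> /imfsetP[/= x xC xn]; have [c' _ c'K] := hc.
  exists (c' [` xC]%fset), ((2 * n - 1 - x) %/ 4)%Z.
  by rewrite c'K /=; lia.
have [N [mN N0 subN]] := ae_tree_error_small hmut c_res.
exists N; split=> // L nL; apply: subN => hL; apply: nL.
apply: (spectrum_of_small_tree_error hmu4) => [p|]; last exact: hL.
exact/c_odd/valP.
Qed.
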